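(* Let $H_S$ be a Hilbert space, let $G$ be a locally compact Hausdorff, second countable topological group, and let $(H_S,U_S)$ be a unitary representation of $G$ on $H_S$. Let $(H_R,E,U_R)$ be a covariant system for $G$, and let $\yen_E$ be its associated relativization map. Then the data $((G,(H_S,U_S),(H_R,U_R)),\yen_E)$ defines a Hilbert module quantum reference frame for $H_S$. That is, for the $G$-equivariant coupling associated to $(G,(H_S,U_S),(H_R,U_R))$, whose relational joint space is canonically identified with $H_S\hat\otimes H_R$, the map $\yen_E$ is a relativization map: it takes values in $\mathcal{B}(H_S\hat\otimes H_R)^{\mathrm{Ad}(U_S\hat\otimes U_R)}$, it is completely positive, it is strictly continuous on the unit ball of $\mathcal{B}(H_S)$, and $\yen_E(T)=T\hat\otimes I$ for all $T\in\mathcal{B}(H_S)^{\mathrm{Ad}(U_S)}$.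
   Context: Inner products are conjugate-linear in the first variable. $\hat\otimes$ is the Hilbert space tensor product. For a unitary representation $U$ of $G$, $\mathrm{Ad}(U)$ is the action $T\mapsto U_gTU_g^*$ and $\mathcal{B}(H)^{\mathrm{Ad}(U)}$ is its fixed-point algebra. The strict topology on $\mathcal{B}(H)$ is generated by the seminorms $T\mapsto\|Tx\|$ and $T\mapsto\|T^*x\|$, $x\in H$. Covariant system (Loveridge, Miyadera, Busch): a triple $(H_R,E,U_R)$ where $H_R$ is a Hilbert space, $U_R$ is a unitary representation of $G$ on $H_R$, and $E:\mathrm{Bor}(G)\to\mathcal{B}(H_R)$ is a normalized positive operator valued measure with $U_R(g)E(B)U_R(g)^*=E(gB)$ for all $g\in G$, $B\in\mathrm{Bor}(G)$. Unitary representations here are strongly continuous. Its relativization map is $\yen_E:\mathcal{B}(H_S)\to\mathcal{B}(H_S\hat\otimes H_R)$, $\yen_E(T)=\int_G U_S(g)TU_S(g)^*\otimes dE(g)$, i.e. the bounded operator determined by $\langle \xi\otimes\eta,\yen_E(T)(\xi'\otimes\eta')\rangle=\int_G\langle\xi,U_S(g)TU_S(g)^*\xi'\rangle\,d\langle\eta,E(g)\eta'\rangle$ for $\xi,\xi'\in H_S$, $\eta,\eta'\in H_R$. Given a group $G$ and unitary representations $(K,W)$, $(H,U)$, the associated $G$-equivariant coupling for the Hilbert space $H$ is the data $(((\mathbb{C},G,\mathrm{triv}),(\mathbb{C},G,\mathrm{triv}),((K,\phi),W)),((\mathbb{C},G,\mathrm{triv}),H,U))$ with $\phi(\lambda)=\lambda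 I_K$. Its relational joint space is canonically $H\hat\otimes K$ with $G$-action $U\hat\otimes W$. A relativization map for it is (under this identification) a completely positive map $\pounds:\mathcal{B}(H)\to\mathcal{B}(H\hat\otimes K)^{\mathrm{Ad}(U\hat\otimes W)}$ which is strictly continuous on the unit ball of $\mathcal{B}(H)$ and satisfies $\pounds(T)=T\hat\otimes I$ for all $T\in\mathcal{B}(H)^{\mathrm{Ad}(U)}$. A Hilbert module quantum reference frame for $H$ (of this form) is such a coupling together with a relativization map for it. *)

(* Defs.v *)
From HB Require Import structures.
From mathcomp Require Import all_boot all_order all_algebra.
From mathcomp Require Import all_classical all_reals all_analysis.
From mathcomp Require Import complex.

Set Implicit Arguments.
Unset Strict Implicit.
Unset Printing Implicit Defensive.

Import Order.TTheory GRing.Theory Num.Theory.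
Import numFieldNormedType.Exports.

Local Open Scope classical_set_scope.
Local Open Scope ring_scope.
Local Open Scope complex_scope.

(* The inner product is linear in the second variable, hence by [dotC]
   conjugate-linear in the first. *)
HB.mixin Record isHilbert (R : realType) (H : Type)
    & CompleteNormedModule R[i] H := {
  dot : H -> H -> R[i] ;
  dotDr : forall x y z, dot x (y + z) = dot x y + dot x z ;
  dotZr : forall (a : R[i]) x y, dot x (a *: y) = a * dot x y ;
  dotC : forall x y, dot y x = (dot x y)^*%C ;
  dot_norm : forall x, dot x x = `|x| ^+ 2
}.

#[short(type="hilbertType")]
HB.structure Definition Hilbert (R : realType) :=
  {H of isHilbert R H & CompleteNormedModule R[i] H}.

Section bounded_operators.
Context (R : realType) (H K : hilbertType R).

Definition bounded_linear : {pred H -> K} := mem [set f : H -> K |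
  linear f /\ exists M : R[i], forall x, `|f x| <= M * `|x|].

Record boundedOp := BoundedOp {
  bounded_fun :> H -> K ;
  bounded_funP : bounded_fun \in bounded_linear }.

HB.instance Definition _ := [isSub for bounded_fun].
HB.instance Definition _ := [Choice of boundedOp by <:].

Lemma bounded_linear_submod_closed : submod_closed bounded_linear.
Proof.
split=> [|a f g]; rewrite !inE.
  split=> [b x y|]; first by rewrite /= scaler0 addr0.
  by exists 0 => x; rewrite normr0 mul0r.
move=> [lf [M Mf]] [lg [N Ng]]; split=> [b x y|].
  change (a *: f (b *: x + y) + g (b *: x + y) =
    b *: (a *: f x + g x) + (a *: f y + g y)).
  by rewrite lf lg !scalerDr !scalerA [b * a]mulrC addrACA.
exists (`|a| * M + N) => x; apply: (le_trans (ler_normD _ _)).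
rewrite mulrDl lerD// [X in `|X| <= _](_ : _ = a *: f x)// normrZ -mulrA.
by rewrite ler_wpM2l.
Qed.

HB.instance Definition _ := GRing.isSubmodClosed.Build _ _ bounded_linear
  bounded_linear_submod_closed.
HB.instance Definition _ := [SubChoice_isSubLmodule of boundedOp by <:].

End bounded_operators.

Notation "''B' ( H )" := (boundedOp H H) (format "''B' ( H )") : type_scope.

Section operator_algebra.
Context (R : realType).
Implicit Types H K L : hilbertType R.

Lemma id_op_subproof H : (idfun : H -> H) \in @bounded_linear R H H.
Proof.
by rewrite inE; split=> //; exists 1 => x; rewrite mul1r.
Qed.

Definition id_op H : 'B(H) := BoundedOp (id_op_subproof H).

Lemma comp_op_subproof H K L (S : boundedOp K L) (T : boundedOp H K) :
  S \o T \in @bounded_linear R H L.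
Proof.
have := bounded_funP S; have := bounded_funP T; rewrite !inE.
move=> [lT [M MT]] [lS [N NS]]; split=> [a x y|]; first by rewrite /= lT lS.
have [N0|N0] := boolP (0 <= N).
  exists (N * M) => x; apply: (le_trans (NS _)).
  by rewrite -mulrA; apply: ler_wpM2l.
exists M => x; have [Tx0|Tx0] := eqVneq (T x) 0.
  rewrite (_ : (S \o T) x = 0) ?normr0 ?(le_trans _ (MT x))//.
  apply/eqP; rewrite -normr_le0; apply: (le_trans (NS _)).
  by rewrite Tx0 normr0 mulr0.
move/negP: N0; case; have := le_trans (normr_ge0 _) (NS (T x)).
by rewrite pmulr_lge0// normr_gt0.
Qed.

Definition comp_op H K L (S : boundedOp K L) (T : boundedOp H K) :
  boundedOp H L := BoundedOp (comp_op_subproof S T).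

(* By the Riesz representation theorem the set below is a singleton. *)
Definition adjoint H K (T : boundedOp H K) : boundedOp K H :=
  xget 0 [set S : boundedOp K H |
           forall x y, dot (S x) y = dot x (T y)].

Definition positive_op H (T : 'B(H)) := forall x, 0 <= dot x (T x).

(* Positivity of [T] as an operator on the n-fold direct sum of [H]. *)
Definition positive_mx H n (T : 'M['B(H)]_n) :=
  forall x : 'I_n -> H, 0 <= \sum_i \sum_j dot (x i) (T i j (x j)).

Definition completely_positive H K (f : 'B(H) -> 'B(K)) :=
  linear f /\
  forall n (T : 'M['B(H)]_n), positive_mx T -> positive_mx (map_mx f T).

(* |T| <= 1 for the operator norm. *)
Definition unit_ball H : set 'B(H) :=
  [set T | forall x, `|T x| <= `|x|].

(* The coarsest topology making every T |-> T x and T |-> T^* x continuous,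
   i.e. the one generated by the seminorms T |-> |T x| and T |-> |T^* x|. *)
Definition strict_eval H (T : 'B(H)) : {ptws H -> (H * H)%type} :=
  fun x => (T x, adjoint T x).

Definition strict H := initial_topology (@strict_eval H).
HB.instance Definition _ H := Topological.on (strict H).

Definition strictly_continuous_on_ball H K (f : 'B(H) -> 'B(K)) :=
  {within @unit_ball H : set (strict H),
    continuous (f : strict H -> strict K)}.

(* [fixed_points U] is B(H)^Ad(U). *)
Definition fixed_points (G : Type) H (U : G -> 'B(H)) : set 'B(H) :=
  [set T | forall g, comp_op (U g) (comp_op T (adjoint (U g))) = T].

End operator_algebra.

(* [HT], with the elementary tensors given by [tens], is a Hilbert space tensor
   product of [H] and [K]; such data are unique up to a unique unitary. *)
Record hilbert_tensor (R : realType) (H K HT : hilbertType R) := HilbertTensor {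
  tens :> H -> K -> HT ;
  tens_linearl : forall y, linear (tens^~ y) ;
  tens_linearr : forall x, linear (tens x) ;
  tens_dot : forall x y x' y',
    dot (tens x y) (tens x' y') = dot x x' * dot y y' ;
  tens_dense : closure [set v | exists n (x : 'I_n -> H) (y : 'I_n -> K),
    v = \sum_i tens (x i) (y i)] = [set: HT] }.

(* The operator S (x) T, determined by its values on elementary tensors. *)
Definition tensor_op (R : realType) (H K HT : hilbertType R)
    (t : hilbert_tensor H K HT) (S : 'B(H)) (T : 'B(K)) : 'B(HT) :=
  xget 0 [set V : 'B(HT) | forall x y, V (t x y) = t (S x) (T y)].

(* [Pointed] is only there because the library generates sigma-algebras on
   pointed types; the distinguished point plays no role. *)
HB.mixin Record isTopologicalGroup G & PointedTopological G & Group G := {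
  mulg_continuous : continuous (fun x : G * G => (x.1 * x.2)%g) ;
  invg_continuous : continuous (fun x : G => (x^-1)%g)
}.

#[short(type="topologicalGroupType")]
HB.structure Definition TopologicalGroup :=
  {G of PointedTopological G & Group G & isTopologicalGroup G}.

Definition Bor (G : topologicalGroupType) := g_sigma_algebraType (@open G).
HB.instance Definition _ (G : topologicalGroupType) := Measurable.on (Bor G).

Record unitary_rep (R : realType) (G : topologicalGroupType)
    (H : hilbertType R) := UnitaryRep {
  rep_op :> G -> 'B(H) ;
  rep1 : rep_op 1%g = id_op H ;
  repM : forall g h, rep_op (g * h)%g = comp_op (rep_op g) (rep_op h) ;
  rep_unitaryl : forall g, comp_op (adjoint (rep_op g)) (rep_op g) = id_op H ;
  rep_unitaryr : forall g, comp_op (rep_op g) (adjoint (rep_op g)) = id_op H ;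
  rep_continuous : forall x, continuous (fun g => rep_op g x) }.

(* Countable additivity is required in the weak operator topology. *)
Record povm (R : realType) (G : topologicalGroupType) (H : hilbertType R) :=
  Povm {
  povm_fun :> set (Bor G) -> 'B(H) ;
  povm_ge0 : forall B, measurable B -> positive_op (povm_fun B) ;
  povm0 : povm_fun set0 = 0 ;
  povmT : povm_fun setT = id_op H ;
  povm_sigma_additive : forall F : nat -> set (Bor G),
    (forall n, measurable (F n)) -> trivIset setT F ->
    forall x y, (fun n => \sum_(0 <= i < n) dot x (povm_fun (F i) y) : R[i]^o)
      @ \oo --> (dot x (povm_fun (\bigcup_n F n) y) : R[i]^o) }.

Record covariant_system (R : realType) (G : topologicalGroupType) :=
  CovariantSystem {
  cs_space : hilbertType R ;
  cs_povm : povm G cs_space ;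
  cs_rep : unitary_rep G cs_space ;
  cs_covariant : forall (g : G) (B : set (Bor G)), measurable B ->
    comp_op (cs_rep g) (comp_op (cs_povm B) (adjoint (cs_rep g))) =
    cs_povm [set (g * h)%g | h in B] }.

Section povm_charges.
Context (R : realType) (G : topologicalGroupType) (H : hilbertType R).
Variables (E : povm G H) (x y : H).

(* Real and imaginary parts of the complex measure B |-> <x, E(B) y>. *)
Definition povm_re (B : set (Bor G)) : \bar R := (complex.Re (dot x (E B y)))%:E.
Definition povm_im (B : set (Bor G)) : \bar R := (complex.Im (dot x (E B y)))%:E.

Let dot0 (z : H) : dot z 0 = 0.
Proof. by rewrite -(scale0r (0 : H)) dotZr mul0r. Qed.

Let povm_re0 : povm_re set0 = 0%E.
Proof. by rewrite /povm_re povm0 dot0. Qed.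

Let povm_im0 : povm_im set0 = 0%E.
Proof. by rewrite /povm_im povm0 dot0. Qed.

Let povm_re_fin B : measurable B -> povm_re B \is a fin_num.
Proof. by []. Qed.

Let povm_im_fin B : measurable B -> povm_im B \is a fin_num.
Proof. by []. Qed.

Let sigma_part (p : R[i] -> R) :
  (forall z w, p (z - w) = p z - p w) -> (forall z, `|p z|%:C <= `|z|) ->
  semi_sigma_additive (fun B : set (Bor G) => (p (dot x (E B y)))%:E).
Proof.
move=> pB pz F mF tF _.
have p0 : p 0 = 0 by have := pB 0 0; rewrite !subrr.
have pD z w : p (z + w) = p z + p w.
  by rewrite -{1}[w]opprK pB -(sub0r w) pB p0 sub0r opprK.
under eq_fun do rewrite sumEFin -(big_morph p pD p0).
apply: cvg_EFin; first exact: nearW.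
have /cvgrPdist_lt/= ul := @povm_sigma_additive _ _ _ E _ mF tF x y.
apply/cvgrPdist_lt => e e0.
have eC : 0 < e%:C by rewrite ltcR.
near=> n; rewrite /= -pB -ltcR (le_lt_trans (pz _))//.
by near: n; exact: ul.
Unshelve. all: by end_near. Qed.

Let povm_re_sigma : semi_sigma_additive povm_re.
Proof.
apply: sigma_part => [[a b] [c d]//|z]; exact: normc_ge_Re.
Qed.

Let povm_im_sigma : semi_sigma_additive povm_im.
Proof.
apply: sigma_part => [[a b] [c d]//|[a b]]; rewrite normc_def lecR/=.
by rewrite -sqrtr_sqr ler_wsqrtr// lerDr sqr_ge0.
Qed.

HB.instance Definition _ := isCharge.Build _ (Bor G) R povm_re
  povm_re0 povm_re_fin povm_re_sigma.
HB.instance Definition _ := isCharge.Build _ (Bor G) R povm_im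
  povm_im0 povm_im_fin povm_im_sigma.

End povm_charges.

Definition charge_integral d (T : measurableType d) (R : realType)
    (nu : {charge set T -> \bar R}) (f : T -> R) : R :=
  let P := cid (Hahn_decomposition nu) in
  let N := cid (svalP P) in
  \int[jordan_pos (svalP N)]_x f x - \int[jordan_neg (svalP N)]_x f x.

(* The integral of [f] with respect to the complex measure nu + i mu. *)
Definition complex_integral d (T : measurableType d) (R : realType)
    (nu mu : {charge set T -> \bar R}) (f : T -> R[i]) : R[i] :=
  (charge_integral nu (fun t => complex.Re (f t)) -
   charge_integral mu (fun t => complex.Im (f t))) +i*
  (charge_integral nu (fun t => complex.Im (f t)) +
   charge_integral mu (fun t => complex.Re (f t))).

(* The integral of [f] with respect to B |-> <x, E(B) y>. *)
Definition povm_integral (R : realType) (G : topologicalGroupType)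
    (H : hilbertType R) (E : povm G H) (x y : H) (f : G -> R[i]) : R[i] :=
  complex_integral (povm_re E x y) (povm_im E x y) (f : Bor G -> R[i]).

(* The relativization map of [C].  The elementary tensors are total, so at most
   one bounded operator has the prescribed matrix coefficients. *)
Definition yen (R : realType) (G : topologicalGroupType)
    (HS : hilbertType R) (US : unitary_rep G HS) (C : covariant_system R G)
    (HT : hilbertType R) (t : hilbert_tensor HS (cs_space C) HT)
    (T : 'B(HS)) : 'B(HT) :=
  xget 0 [set V : 'B(HT) | forall xi xi' eta eta',
    dot (t xi eta) (V (t xi' eta')) =
    povm_integral (cs_povm C) eta eta' (fun g =>
      dot xi (comp_op (US g) (comp_op T (adjoint (US g))) xi'))].

(* The equivariant coupling for [cp_system] associated with [cp_system_rep] and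
   [cp_frame_rep].  Its coefficient algebras are the complex numbers with the
   trivial action of [G], acting on [cp_frame] by scalar multiples of the
   identity, so that they carry no further data. *)
Record coupling (R : realType) (G : topologicalGroupType) := Coupling {
  cp_system : hilbertType R ;
  cp_system_rep : unitary_rep G cp_system ;
  cp_frame : hilbertType R ;
  cp_frame_rep : unitary_rep G cp_frame }.

Definition associated_coupling (R : realType) (G : topologicalGroupType)
    (HS : hilbertType R) (US : unitary_rep G HS)
    (K : hilbertType R) (W : unitary_rep G K) : coupling R G :=
  Coupling US W.

Section frames.
Context (R : realType) (G : topologicalGroupType) (c : coupling R G).
Context (J : hilbertType R) (t : hilbert_tensor (cp_system c) (cp_frame c) J).

Definition joint_action (g : G) : 'B(J) :=
  tensor_op t (cp_system_rep c g) (cp_frame_rep c g).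

Record relativization_map (f : 'B(cp_system c) -> 'B(J)) : Prop :=
  RelativizationMap {
  relativization_fixed : forall T, fixed_points joint_action (f T) ;
  relativization_cp : completely_positive f ;
  relativization_strict : strictly_continuous_on_ball f ;
  relativization_id : forall T, fixed_points (cp_system_rep c) T ->
    f T = tensor_op t T (id_op (cp_frame c)) }.

(* The coupling [c], with its joint space realized as [J] through [t], and [f]
   form a Hilbert module quantum reference frame for [cp_system c]. *)
Definition hilbert_module_qrf (f : 'B(cp_system c) -> 'B(J)) : Prop :=
  relativization_map f.

End frames.

(* Main.v *)
Require Import Defs.
From HB Require Import structures.
From mathcomp Require Import all_boot all_order all_algebra.
From mathcomp Require Import all_classical all_reals all_analysis.
From mathcomp Require Import measurable_realfun complex ring lra.

Set Implicit Arguments.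
Unset Strict Implicit.
Unset Printing Implicit Defensive.

Import Order.TTheory GRing.Theory Num.Theory.
Import numFieldNormedType.Exports.

Import complex.ComplexField.Normc.
Local Open Scope classical_set_scope.
Local Open Scope ring_scope.
Local Open Scope complex_scope.

(** Everything about the relativization map is read off from one positivity
    principle ([povm_integral_psd]): if (f_ij(g)) is a positive semidefinite
    matrix for every g, then so is the matrix of the integrals of f_ij against
    the complex measures <eta_i, E(.) eta_j>.  Replacing the integrals by
    Riemann sums over one common finite Borel partition, this is the Schur
    product theorem for the matrices (f_ij(g_l)) and (<eta_i, E(A_l) eta_j>),
    the second being positive because E(A_l) is.  Riemann sums
    ([povm_integral_approx]) are also the only way in which the integral is
    accessed: its linearity, conjugation and invariance properties are those of
    finite sums.

    Existence.  For xi, xi' in the system space the integrand is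
    <U_g^* xi, T U_g^* xi'>.  The Gram matrix of the vectors U_g^* xi_i and
    T U_g^* xi'_j is positive, so the principle gives a Cauchy-Schwarz
    inequality ([yform_schwarz]): the form b_T of T on finite sums of elementary
    tensors satisfies |b_T(v, w)|^2 <= |v|^2 Q_T(w), where Q_T integrates the
    products <T U_g^* xi, T U_g^* xi'>.  The principle applied to the matrices
    of M^2 - T^* T, for |T| <= M, gives Q_T(w) <= M^2 |w|^2 ([ysquare_le]).
    Hence b_T is bounded and, by the Riesz theorem ([riesz_graph], [form_op]),
    it is the form of an operator.  Since elementary tensors are total, an
    identity between operators only has to be checked on their matrix
    coefficients; this yields linearity, the formula for the adjoint, the
    invariance under the joint action (covariance of E is a change of variables,
    [povm_integral_translate]) and the value T (x) 1 on invariant T, for which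
    the integrand is constant.

    Complete positivity is the principle for the matrices
    <U_g^* xi_k, T_kl U_g^* xi_l>.

    Strict continuity.  The adjoint of the relativization of T is the
    relativization of T^*, and the unit ball and the elementary tensors reduce
    the claim to: if S tends to 0 strongly and stays bounded, then the
    relativization of S tends to 0 on xi (x) eta.  Its squared norm there is at
    most the integral of |S U_g^* xi|^2 against <eta, E(.) eta>
    ([yen_schwarz]).  Along a filter there is no dominated convergence, but [G]
    is second countable and the orbit of xi is continuous, so [G] splits into
    countably many Borel pieces on which U_g^* xi is almost constant; finitely
    many of them carry all but a small part of the measure, and on these
    |S U_g^* xi| is controlled by finitely many vectors ([ysquare_small]). *)

(** * Complex numbers, vectors and bounded operators *)

Section complex_numbers.
Context {R : realType}.
Local Notation C := R[i].
Implicit Types (z w : C) (r : R).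

Lemma ReD z w : complex.Re (z + w) = complex.Re z + complex.Re w.
Proof. by case: z w => [? ?] [? ?]. Qed.

Lemma ReN z : complex.Re (- z) = - complex.Re z.
Proof. by case: z. Qed.

Lemma ReB z w : complex.Re (z - w) = complex.Re z - complex.Re w.
Proof. by case: z w => [? ?] [? ?]. Qed.

Lemma ImB z w : complex.Im (z - w) = complex.Im z - complex.Im w.
Proof. by case: z w => [? ?] [? ?]. Qed.

Lemma ReJ z : complex.Re z^*%C = complex.Re z.
Proof. by case: z. Qed.

Lemma ReZ r z : complex.Re (r%:C * z) = r * complex.Re z.
Proof. by case: z => a b; rewrite /= mul0r subr0. Qed.

Lemma ReMi z : complex.Re ('i * z) = - complex.Im z.
Proof. by case: z => a b; rewrite /= mul0r mul1r add0r. Qed.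

Lemma complex_eqP z w :
  complex.Re z = complex.Re w -> complex.Im z = complex.Im w -> z = w.
Proof. by case: z w => [a b] [c d] /= -> ->. Qed.

Lemma normr_normc z : `|z| = (normc z)%:C.
Proof. by []. Qed.

Lemma normc_ge0 z : 0 <= normc z.
Proof. by case: z => a b; exact: sqrtr_ge0. Qed.

Lemma normc_sqr z : normc z ^+ 2 = complex.Re z ^+ 2 + complex.Im z ^+ 2.
Proof. by case: z => a b; rewrite sqr_sqrtr// addr_ge0// sqr_ge0. Qed.

Lemma mulJc z : z^*%C * z = (normc z ^+ 2)%:C.
Proof. by rewrite mulrC -sqr_normc normr_normc rmorphXn. Qed.

Lemma normc_le_Re z : `|complex.Re z| <= normc z.
Proof. by have := normc_ge_Re z; rewrite normr_normc lecR. Qed.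

Lemma normc_le_Im z : `|complex.Im z| <= normc z.
Proof.
by case: z => a b; rewrite /= -sqrtr_sqr ler_wsqrtr// lerDr sqr_ge0.
Qed.

Lemma normc_le z : normc z <= `|complex.Re z| + `|complex.Im z|.
Proof.
have h : 0 <= `|complex.Re z| + `|complex.Im z| by rewrite addr_ge0.
rewrite -(ler_pXn2r (n := 2))// ?nnegrE ?normc_ge0//.
rewrite normc_sqr sqrrD !real_normK ?num_real// [X in _ <= X]addrAC lerDl.
by rewrite mulrn_wge0// mulr_ge0.
Qed.

Lemma normc_conj z : normc z^*%C = normc z.
Proof. by case: z => a b /=; rewrite sqrrN. Qed.

Lemma normcR r : normc r%:C = `|r|.
Proof. by rewrite /= expr0n addr0 sqrtr_sqr. Qed.

Lemma normc_sum (I : Type) (s : seq I) (F : I -> C) :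
  normc (\sum_(i <- s) F i) <= \sum_(i <- s) normc (F i).
Proof.
elim/big_rec2: _ => [|i r z _ h]; first by rewrite normc0.
by rewrite (le_trans (le_normcD _ _))// lerD2l.
Qed.

Lemma ge0_complexE z : (0 <= z) = (complex.Im z == 0) && (0 <= complex.Re z).
Proof. by rewrite lecE. Qed.

(** Closedness of the cone of nonnegative numbers, in the form in which it
    transfers positivity from Riemann sums to integrals. *)
Lemma ge0_approx z :
  (forall e, 0 < e -> exists2 w, 0 <= w & normc (z - w) <= e) -> 0 <= z.
Proof.
move=> h; rewrite ge0_complexE; apply/andP; split.
  rewrite -normr_eq0 eq_le normr_ge0 andbT; apply/ler_addgt0Pl => e e0.
  rewrite addr0; have [w w0 /(le_trans (normc_le_Im _))] := h _ e0.
  by case: z w w0 {h} => [a b] [c d]/=; rewrite ge0_complexE/= => /andP[/eqP-> _];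
    rewrite subr0.
apply/ler_addgt0Pl => e e0; have [w w0 /(le_trans (normc_le_Re _))] := h _ e0.
rewrite ReB ler_norml => /andP[+ _]; move: w0; rewrite ge0_complexE => /andP[_].
by rewrite addrC; lra.
Qed.

Lemma eq_approx z w : (forall e, 0 < e -> normc (z - w) <= e) -> z = w.
Proof.
move=> h; apply/subr0_eq/eq0_normc/le_anti; rewrite normc_ge0 andbT.
by apply/ler_addgt0Pl => e e0; rewrite addr0 h.
Qed.

(** The Cauchy-Schwarz inequality for a positive form in two dimensions with
    diagonal entries [a], [b] and off-diagonal entry [z]: the bound comes from
    the multiple [l] of the conjugate of [z] that minimises the expression. *)
Lemma psd2_bound (a b : R) z : 0 <= a ->
  (forall l : C, 0 <= normc l ^+ 2 * a + b + 2 * complex.Re (l * z)) ->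
  normc z ^+ 2 <= a * b.
Proof.
move=> a0 h.
have k (t : R) : 0 <= t ^+ 2 * normc z ^+ 2 * a + b - 2 * t * normc z ^+ 2.
  have := h ((- t)%:C * z^*%C); rewrite normcM normcR normc_conj exprMn.
  rewrite real_normK ?num_real// sqrrN -mulrA mulJc ReZ/=.
  by congr (0 <= _); ring.
have := sqr_ge0 (normc z); move: k; move: (normc z ^+ 2) => n k n0.
move: a0; rewrite le_eqVlt => /predU1P[a0|a0].
  (* For a = 0 the expression is affine in t, so n must vanish. *)
  rewrite -a0 mul0r leNgt; apply/negP => np.
  have := k ((b + 1) / (2 * n)); rewrite -a0 mulr0 add0r.
  have -> : 2 * ((b + 1) / (2 * n)) * n = b + 1 by field; rewrite gt_eqF.
  by lra.
have := k a^-1; have -> : a^-1 ^+ 2 * n * a + b - 2 * a^-1 * n = b - n / a.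
  by field; rewrite gt_eqF.
by rewrite subr_ge0 ler_pdivrMr// mulrC.
Qed.

End complex_numbers.

Section hilbert_basics.
Context {R : realType} {H : hilbertType R}.
Local Notation C := R[i].
Implicit Types (x y z : H) (a : C).

Lemma dot0r x : dot x 0 = 0.
Proof. by rewrite -(scale0r (0 : H)) dotZr mul0r. Qed.

Lemma dotDl x y z : dot (x + y) z = dot x z + dot y z.
Proof. by rewrite dotC dotDr rmorphD (dotC z x) (dotC z y). Qed.

Lemma dotZl a x y : dot (a *: x) y = a^*%C * dot x y.
Proof. by rewrite dotC dotZr rmorphM (dotC y x). Qed.

Lemma dot0l x : dot 0 x = 0.
Proof. by rewrite dotC dot0r conjc0. Qed.

Lemma dotNr x y : dot x (- y) = - dot x y.
Proof. by rewrite -scaleN1r dotZr mulN1r. Qed.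

Lemma dotBr x y z : dot x (y - z) = dot x y - dot x z.
Proof. by rewrite dotDr dotNr. Qed.

Lemma dotBl x y z : dot (x - y) z = dot x z - dot y z.
Proof. by rewrite dotC dotBr rmorphB (dotC z x) (dotC z y). Qed.

Lemma dot_sumr (I : Type) (s : seq I) (P : pred I) x (F : I -> H) :
  dot x (\sum_(i <- s | P i) F i) = \sum_(i <- s | P i) dot x (F i).
Proof. exact: (big_morph _ (dotDr x) (dot0r x)). Qed.

Lemma dot_suml (I : Type) (s : seq I) (P : pred I) x (F : I -> H) :
  dot (\sum_(i <- s | P i) F i) x = \sum_(i <- s | P i) dot (F i) x.
Proof.
by apply: (big_morph (fun y => dot y x) _ (dot0l x)) => y z; exact: dotDl.
Qed.

(** The norm of a vector as a real number: the order on complex numbers is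
    partial, so inequalities are more convenient in [R]. *)
Definition nrm x : R := complex.Re `|x|.

Lemma nrmE x : `|x| = (nrm x)%:C.
Proof. by rewrite /nrm RRe_real// normr_real. Qed.

Lemma nrm_ge0 x : 0 <= nrm x.
Proof. by rewrite -ler0c -nrmE. Qed.

Lemma dotxx x : dot x x = (nrm x ^+ 2)%:C.
Proof. by rewrite dot_norm nrmE rmorphXn. Qed.

Lemma nrm_dot x : nrm x ^+ 2 = complex.Re (dot x x).
Proof. by rewrite dotxx. Qed.

Lemma dotxx_ge0 x : 0 <= dot x x.
Proof. by rewrite dotxx ler0c sqr_ge0. Qed.

Lemma nrmD x y : nrm (x + y) <= nrm x + nrm y.
Proof. by rewrite -lecR rmorphD/= -!nrmE ler_normD. Qed.

Lemma nrmN x : nrm (- x) = nrm x.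
Proof. by rewrite /nrm normrN. Qed.

Lemma nrmBC x y : nrm (x - y) = nrm (y - x).
Proof. by rewrite -nrmN opprB. Qed.

Lemma nrmB x y : nrm (x - y) <= nrm x + nrm y.
Proof. by rewrite (le_trans (nrmD _ _))// nrmN. Qed.

Lemma nrm_triangle z x y : nrm (x - y) <= nrm (x - z) + nrm (z - y).
Proof. by rewrite -[x - y](subrKA z); exact: nrmD. Qed.

Lemma nrmZ a x : nrm (a *: x) = normc a * nrm x.
Proof. by apply/complexI; rewrite -nrmE normrZ rmorphM/= -nrmE. Qed.

Lemma nrm0 : nrm (0 : H) = 0.
Proof. by rewrite /nrm normr0. Qed.

Lemma nrm_eq0 x : nrm x = 0 -> x = 0.
Proof. by move=> x0; apply/eqP; rewrite -normr_eq0 nrmE x0. Qed.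

Lemma nrm_le_sqr x (M : R) : 0 <= M -> nrm x ^+ 2 <= M ^+ 2 -> nrm x <= M.
Proof. by move=> M0; rewrite ler_pXn2r// nnegrE nrm_ge0. Qed.

Lemma nrmD_sqr x y :
  nrm (x + y) ^+ 2 = nrm x ^+ 2 + nrm y ^+ 2 + 2 * complex.Re (dot x y).
Proof.
rewrite !nrm_dot dotDl !dotDr (dotC x y) !ReD ReJ.
by rewrite mulr2n mulrDl mul1r; ring.
Qed.

Lemma cauchy_schwarz x y : normc (dot x y) <= nrm x * nrm y.
Proof.
rewrite -(ler_pXn2r (n := 2))// ?nnegrE ?normc_ge0 ?mulr_ge0 ?nrm_ge0//.
rewrite exprMn; apply: psd2_bound; first by rewrite sqr_ge0.
move=> l; have := sqr_ge0 (nrm (l^*%C *: x + y)).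
by rewrite nrmD_sqr nrmZ normc_conj exprMn dotZl conjcK.
Qed.

Lemma dot_inj x y : (forall z, dot z x = dot z y) -> x = y.
Proof.
move=> h; apply/subr0_eq/nrm_eq0/eqP; rewrite -sqrf_eq0 nrm_dot.
by rewrite dotBr h subrr.
Qed.

Lemma nrm_le_dot x (M : R) : 0 <= M ->
  (forall y, normc (dot y x) <= M * nrm y) -> nrm x <= M.
Proof.
move=> M0 h; have := h x; rewrite dotxx normcR ger0_norm ?sqr_ge0// expr2.
have := nrm_ge0 x; rewrite le_eqVlt => /predU1P[<-//|x0].
by rewrite ler_pM2r.
Qed.

End hilbert_basics.

Section bounded_operator_basics.
Context {R : realType} {H K : hilbertType R}.
Local Notation C := R[i].
Implicit Types (S T : boundedOp H K) (x y z : H) (a : C).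

Lemma op_linear T a x y : T (a *: x + y) = a *: T x + T y.
Proof. by have := Defs.bounded_funP T; rewrite inE => -[lT _]; exact: (lT a x y). Qed.

Lemma opD T x y : T (x + y) = T x + T y.
Proof. by have := op_linear T 1 x y; rewrite !scale1r. Qed.

Lemma op0 T : T 0 = 0.
Proof. by have := op_linear T (-1) 0 0; rewrite !scaleN1r !addNr. Qed.

Lemma opZ T a x : T (a *: x) = a *: T x.
Proof. by have := op_linear T a x 0; rewrite op0 !addr0. Qed.

Lemma opB T x y : T (x - y) = T x - T y.
Proof. by rewrite opD -scaleN1r opZ scaleN1r. Qed.

Lemma op_sum (I : Type) (s : seq I) (P : pred I) T (F : I -> H) :
  T (\sum_(i <- s | P i) F i) = \sum_(i <- s | P i) T (F i).
Proof. exact: (big_morph _ (opD T) (op0 T)). Qed.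

Lemma op_bound T : exists2 M : R, 0 <= M & forall x, nrm (T x) <= M * nrm x.
Proof.
have := Defs.bounded_funP T; rewrite inE => -[_ [M hM]].
exists `|complex.Re M| => // x; have := hM x.
rewrite !nrmE => /(le_trans _) h.
have : (nrm (T x))%:C <= M * (nrm x)%:C by rewrite -!nrmE; exact: hM.
rewrite lecE /= => /andP[_]; rewrite mulrC ReZ mulrC => /le_trans; apply.
by rewrite ler_wpM2r ?nrm_ge0// ler_norm.
Qed.

Lemma boundedOp_eq S T : (forall x, S x = T x) -> S = T.
Proof. by move=> h; apply: val_inj; apply/funext. Qed.

Lemma bounded_operator (f : H -> K) (M : R) :
  (forall a x y, f (a *: x + y) = a *: f x + f y) ->
  (forall x, nrm (f x) <= M * nrm x) ->
  exists T : boundedOp H K, forall x, T x = f x.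
Proof.
move=> lf bf; have fP : f \in @bounded_linear R H K.
  rewrite inE; split=> //; exists M%:C => x.
  by rewrite !nrmE -rmorphM lecR.
by exists (BoundedOp fP).
Qed.

End bounded_operator_basics.

(** By polarization: the values at [x + y] and [x + 'i y] are real, which gives
    the imaginary and the real part of the identity. *)
Lemma positive_op_herm {R : realType} {H : hilbertType R} (T : 'B(H)) x y : positive_op T ->
  dot x (T y) = (dot y (T x))^*%C.
Proof.
move=> T0; have im z : complex.Im (dot z (T z)) = 0.
  by apply/eqP; have := T0 z; rewrite ge0_complexE => /andP[].
move: (im (x + y)) (im (x + 'i *: y)) (im x) (im y).
rewrite !opD !opZ !dotDl !dotDr !dotZl !dotZr.
case: (dot x (T x)) => ? ?; case: (dot y (T y)) => ? ?.
case: (dot x (T y)) => a b; case: (dot y (T x)) => c d /= h1 h2 h3 h4.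
by rewrite h3 h4 in h1 h2; apply: complex_eqP => /=; lra.
Qed.

(** * The Riesz representation theorem and adjoints *)

Section riesz.
Context {R : realType} {H : hilbertType R}.
Local Notation C := R[i].

Let linear_le_quadratic (d n : R) : 0 <= n ->
  (forall t, 2 * t * d <= t ^+ 2 * n) -> d = 0.
Proof.
move=> n0 /(_ (d / (n + 1))) h; have n1 : 0 < n + 1 by rewrite ltr_wpDl.
have {h} : 2 * d ^+ 2 * (n + 1) <= d ^+ 2 * n.
  rewrite -(ler_pM2r (x := (n + 1)^-2)) ?invr_gt0 ?exprn_gt0//.
  apply: le_trans (le_trans h _); rewrite le_eqVlt; apply/orP; left; apply/eqP.
  - by field; rewrite gt_eqF.
  - by field; rewrite gt_eqF.
move=> h; apply/eqP; rewrite -sqrf_eq0 eq_le sqr_ge0 andbT.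
have := sqr_ge0 d; move: h; move: (d ^+ 2) => x; nra.
Qed.

(** The vector [z] is the limit of a minimising sequence of |v|^2 - 2 Re s over
    the pairs (v, s) in [D]; this sequence converges by the parallelogram law,
    and [z] represents the functional because the quadratic expression is
    stationary there.  Describing the functional by its graph makes the result
    apply directly to functionals known on combinations of a family, where a
    vector may have many expressions. *)
Lemma riesz_graph (D : set (H * C)) (M : R) :
  D (0, 0) ->
  (forall a p q, D p -> D q -> D (a *: p.1 + q.1, a * p.2 + q.2)) ->
  0 <= M -> (forall p, D p -> normc p.2 <= M * nrm p.1) ->
  exists z, forall p, D p -> dot z p.1 = p.2.
Proof.
move=> D0 Dlin M0 Dbd.
pose J (p : H * C) := nrm p.1 ^+ 2 - 2 * complex.Re p.2.
have Jlb p : D p -> - M ^+ 2 <= J p.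
  move=> /Dbd /(le_trans (normc_le_Re _)) /ler_normlW h; rewrite /J.
  by have := sqr_ge0 (nrm p.1 - M); nra.
pose A := [set J p | p in D]; pose m := inf A.
have Ainf : has_inf A.
  split; first by exists (J (0, 0)), (0, 0).
  by exists (- M ^+ 2) => _ [p Dp <-]; exact: Jlb.
have Jm p : D p -> m <= J p.
  by move=> Dp; apply: ge_inf; [exact: Ainf.2|exists p].
have Jlin a p q : J (a *: p.1 + q.1, a * p.2 + q.2) =
    normc a ^+ 2 * nrm p.1 ^+ 2 - 2 * complex.Re (a * p.2) + J q +
    2 * complex.Re (a^*%C * dot p.1 q.1).
  by rewrite /J/= nrmD_sqr nrmZ dotZl ReD exprMn; ring.
have near_min e : 0 < e -> exists2 p, D p & J p < m + e.
  by move=> e0; have [_ [p Dp <-] h] := inf_adherent e0 Ainf; exists p.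
have par p q : D p -> D q ->
    nrm (p.1 - q.1) ^+ 2 <= 2 * (J p - m) + 2 * (J q - m).
  move=> Dp Dq; have h := Jm _ (Dlin 1 _ _ Dp Dq).
  (* The parallelogram law for p and q: the midpoint of p and q lies in D, so
     its value is at least m. *)
  pose hp : H * C := (2^-1%:C *: p.1 + 0, 2^-1%:C * p.2 + 0).
  have Dh : D hp by exact: (Dlin _ _ (0, 0)).
  have := Jm _ (Dlin 2^-1%:C q hp Dq Dh).
  rewrite Jlin (Jlin _ p (0, 0)) !normcR ger0_norm ?invr_ge0// !conjc_real !ReZ.
  rewrite /J/= nrm0 expr0n/= !dot0r/= !mulr0 subr0 !addr0 dotZr ReZ.
  have -> : nrm (p.1 - q.1) ^+ 2 = nrm p.1 ^+ 2 + nrm q.1 ^+ 2 -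
      2 * complex.Re (dot q.1 p.1).
    by rewrite nrmD_sqr nrmN dotNr ReN (dotC q.1 p.1) ReJ; ring.
  by move: (complex.Re _) (complex.Re _) (complex.Re _) => a b c; lra.
have /choice[u uP] : forall n, exists p, D p /\ J p < m + n.+1%:R^-1.
  by move=> n; have [p ? ?] := @near_min n.+1%:R^-1 ltac:(by rewrite invr_gt0); exists p.
have small (e : R) : 0 < e -> exists N : nat, forall n, (N <= n)%N -> n.+1%:R^-1 < e.
  move=> e0; exists (Num.truncn e^-1) => n Nn.
  rewrite invf_plt ?posrE// (lt_le_trans (truncnS_gt _))//.
  by rewrite ler_nat ltnS.
have : cvg ((fun n => (u n).1) @ \oo).
  apply: cauchy_cvg; apply: cauchy_exP => e.
  rewrite ltcE => /andP[/eqP/= e_im e0].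
  have [N Nh] := @small (complex.Re e ^+ 2 / 4) ltac:(by rewrite divr_gt0// exprn_gt0).
  exists (u N).1; exists N => // n /= Nn; rewrite -ball_normE/= nrmE ltcE/= e_im eqxx/=.
  rewrite -(ltr_pXn2r (n := 2))// ?nnegrE ?nrm_ge0 ?ltW//.
  apply: le_lt_trans (par _ _ (uP N).1 (uP n).1) _.
  have := Nh _ Nn; have := Nh _ (leqnn _); have := (uP N).2; have := (uP n).2.
  by move: (_.+1%:R^-1) (_.+1%:R^-1) => a b; lra.
move=> /cvg_ex[/= z uz]; exists z.
have zP e : 0 < e -> exists p, [/\ D p, nrm (z - p.1) < e & J p < m + e].
  move=> e0; move/cvgrPdist_lt : uz => /(_ e%:C); rewrite ltcR => /(_ e0) uz.
  have [N Nh] := small _ e0.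
  have : \forall n \near \oo, n.+1%:R^-1 < e by exists N.
  move=> /(filterI uz) /filter_ex[n /= [+ ne]].
  rewrite nrmE ltcR => zn; exists (u n); split => //; first exact: (uP n).1.
  by rewrite (lt_trans (uP n).2)// ltrD2l.
(* Stationarity of the minimum along the line z + t p for real t; the factor k
   absorbs the error made in replacing z by a near-minimiser. *)
have zre p : D p -> complex.Re (dot z p.1) = complex.Re p.2.
  move=> Dp; apply/esym/subr0_eq/(linear_le_quadratic (sqr_ge0 (nrm p.1))) => t.
  apply/ler_addgt0Pl => e e0.
  pose k := 1 + 2 * `|t| * nrm p.1.
  have k0 : 0 < k by rewrite ltr_pwDl// !mulr_ge0// nrm_ge0.
  have [q [Dq zq Jq]] := @zP (e / k) ltac:(by rewrite divr_gt0).
  have := Jm _ (Dlin t%:C _ _ Dp Dq); rewrite Jlin normcR real_normK ?num_real//.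
  rewrite conjc_real !ReZ (dotC q.1 p.1) ReJ.
  have : 2 * t * (complex.Re (dot q.1 p.1) - complex.Re (dot z p.1)) <=
      2 * `|t| * (e / k * nrm p.1).
    rewrite -ReB -dotBl -(mulrA 2 t) -(mulrA 2 `|t|) ler_pM2l// (le_trans (ler_norm _))// normrM.
    rewrite ler_wpM2l// (le_trans (normc_le_Re _))//.
    rewrite (le_trans (cauchy_schwarz _ _))// ler_wpM2r ?nrm_ge0//.
    by rewrite nrmBC ltW.
  have ek : e = e / k + 2 * `|t| * (e / k * nrm p.1).
    by rewrite /k; field; rewrite gt_eqF.
  move: Jq ek; move: (complex.Re _) (complex.Re _) (complex.Re _) => c1 c2 c3.
  by move: (J q) (e / k * nrm p.1) (nrm _ ^+ 2) (e / k) => Jq W n ek; nra.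
move=> p Dp; apply: complex_eqP; first exact: zre.
(* The imaginary part is the real part for the pair multiplied by i. *)
have := zre _ (Dlin 'i _ _ Dp D0); rewrite /= !addr0 dotZr !ReMi.
exact: oppr_inj.
Qed.

End riesz.

Section adjoints.
Context {R : realType}.
Local Notation C := R[i].
Implicit Types H K L : hilbertType R.

Lemma adjointP H K (T : boundedOp H K) x y :
  dot (adjoint T x) y = dot x (T y).
Proof.
suff [S hS] : exists S : boundedOp K H, forall x y, dot (S x) y = dot x (T y).
  by rewrite /adjoint; case: xgetP => [_ -> //|/(_ S)]; exact.
have [M M0 TM] := op_bound T.
have /choice[S hS] : forall x, exists z, forall y, dot z y = dot x (T y).
  move=> u; pose D : set (H * C) := [set p | p.2 = dot u (T p.1)].
  have [||||z zP] := @riesz_graph _ _ D (nrm u * M).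
  - by rewrite /D/= op0 dot0r.
  - by move=> a [v s] [w r]; rewrite /D/= => -> ->; rewrite op_linear dotDr dotZr.
  - by rewrite mulr_ge0// nrm_ge0.
  - move=> [v s]; rewrite /D/= => ->; rewrite (le_trans (cauchy_schwarz _ _))//.
    by rewrite -mulrA ler_wpM2l ?nrm_ge0.
  by exists z => v; exact: (zP (v, _)).
have [||S' S'E] := @bounded_operator _ _ _ S M.
- move=> a u v; apply: dot_inj => w.
  rewrite dotC hS dotDr dotZr dotDl dotZl -!hS rmorphD rmorphM/= conjcK.
  by rewrite (dotC (S u) w) (dotC (S v) w).
- move=> u; apply: nrm_le_dot; first by rewrite mulr_ge0// nrm_ge0.
  move=> v; rewrite dotC normc_conj hS (le_trans (cauchy_schwarz _ _))//.
  by rewrite (mulrC M) -mulrA ler_wpM2l// nrm_ge0.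
by exists S' => u v; rewrite S'E hS.
Qed.

Lemma adjointPr H K (T : boundedOp H K) x y :
  dot y (adjoint T x) = dot (T y) x.
Proof. by rewrite dotC adjointP -dotC. Qed.

Lemma adjoint_unique H K (T : boundedOp H K) (S : boundedOp K H) :
  (forall x y, dot (S x) y = dot x (T y)) -> adjoint T = S.
Proof.
move=> h; apply: boundedOp_eq => x; apply: dot_inj => z.
by rewrite (dotC (adjoint T x)) (dotC (S x)) adjointP h.
Qed.

Lemma adjointK H K (T : boundedOp H K) : adjoint (adjoint T) = T.
Proof. by apply: adjoint_unique => x y; rewrite adjointPr. Qed.

Lemma adjointB H K (S T : boundedOp H K) :
  adjoint (S - T) = adjoint S - adjoint T.
Proof.
by apply: adjoint_unique => x y; rewrite dotBl dotBr !adjointP.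
Qed.

Lemma adjoint_bound H K (T : boundedOp H K) (M : R) : 0 <= M ->
  (forall x, nrm (T x) <= M * nrm x) ->
  forall x, nrm (adjoint T x) <= M * nrm x.
Proof.
move=> M0 TM x; apply: nrm_le_dot; first by rewrite mulr_ge0// nrm_ge0.
move=> y; rewrite adjointPr (le_trans (cauchy_schwarz _ _))//.
by rewrite (mulrAC M) ler_wpM2r ?nrm_ge0.
Qed.

End adjoints.

(** * Operators determined by a total family; the Schur product theorem *)

Section total_families.
Context {R : realType} {H : hilbertType R} {I : Type} (t : I -> H).
Local Notation C := R[i].
Implicit Types (r s : seq (C * I)) (a : I) (x y z : H).

(** Linear combinations are indexed by lists so that sums and multiples of
    combinations are concatenations and maps. *)
Definition comb s : H := \sum_(p <- s) p.1 *: t p.2.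

Definition total := forall x (e : R), 0 < e -> exists s, nrm (x - comb s) < e.

Lemma comb_nil : comb [::] = 0.
Proof. by rewrite /comb big_nil. Qed.

Lemma comb1 a : comb [:: (1, a)] = t a.
Proof. by rewrite /comb big_seq1 scale1r. Qed.

Definition scale_comb (c : C) s := [seq (c * p.1, p.2) | p <- s].

Lemma big_scale_comb (V : lmodType C) (F : I -> V) c r s :
  \sum_(p <- scale_comb c r ++ s) p.1 *: F p.2 =
  c *: (\sum_(p <- r) p.1 *: F p.2) + \sum_(p <- s) p.1 *: F p.2.
Proof.
rewrite big_cat big_map scaler_sumr; congr (_ + _).
by apply: eq_bigr => p _; rewrite scalerA.
Qed.

Lemma dot_comb r s : dot (comb r) (comb s) =
  \sum_(p <- r) \sum_(q <- s) p.1^*%C * q.1 * dot (t p.2) (t q.2).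
Proof.
rewrite dot_suml; apply: eq_bigr => p _; rewrite dot_sumr.
by apply: eq_bigr => q _; rewrite dotZl dotZr mulrA.
Qed.

Hypothesis tot : total.

(** Both uniqueness of operators and norm bounds are tested on combinations
    through this estimate. *)
Lemma total_nrm_le x (M : R) : 0 <= M ->
  (forall s, normc (dot (comb s) x) <= M * nrm (comb s)) -> nrm x <= M.
Proof.
move=> M0 h; apply: nrm_le_dot => // y; apply/ler_addgt0Pl => e e0.
have k0 : 0 < nrm x + M + 1 by rewrite ltr_wpDl// addr_ge0// nrm_ge0.
have [s] := @tot y (e / (nrm x + M + 1)) ltac:(by rewrite divr_gt0).
set d := e / _ => ys.
have -> : dot y x = dot (y - comb s) x + dot (comb s) x by rewrite -dotDl subrK.
rewrite (le_trans (le_normcD _ _))// (le_trans (lerD (cauchy_schwarz _ _) (h s)))//.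
have sy : nrm (comb s) <= nrm y + d.
  by rewrite -[comb s](subKr y) (le_trans (nrmB _ _))// lerD2l ltW.
have -> : e = d * (nrm x + M + 1) by rewrite divfK// gt_eqF.
have d0 : 0 < d by rewrite divr_gt0.
have := ler_wpM2l M0 sy; have := ler_wpM2r (nrm_ge0 x) (ltW ys).
by move: (nrm (y - _)) => u; lra.
Qed.

Lemma total_dot_inj x y : (forall a, dot (t a) x = dot (t a) y) -> x = y.
Proof.
move=> h; apply/subr0_eq/nrm_eq0/le_anti; rewrite nrm_ge0 andbT.
apply: total_nrm_le => // s; rewrite mul0r dot_suml big1 ?normc0// => p _.
by rewrite dotZl dotBr h subrr mulr0.
Qed.

Lemma op_eq_total (K : hilbertType R) (S T : boundedOp H K) :
  (forall a, S (t a) = T (t a)) -> S = T.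
Proof.
move=> h; rewrite -[S]adjointK -[T]adjointK; congr adjoint.
apply: boundedOp_eq => x; apply: total_dot_inj => a.
by rewrite !adjointPr h.
Qed.

(** The Riesz theorem applied to the functionals t a |-> <x, V0 a> yields the
    adjoint of the extension. *)
Lemma ext_op (K : hilbertType R) (V0 : I -> K) (M : R) : 0 <= M ->
  (forall s, nrm (\sum_(p <- s) p.1 *: V0 p.2) <= M * nrm (comb s)) ->
  exists V : boundedOp H K,
    (forall a, V (t a) = V0 a) /\ (forall x, nrm (V x) <= M * nrm x).
Proof.
move=> M0 bd.
have /choice[W WE] : forall x : K, exists z : H, forall a, dot z (t a) = dot x (V0 a).
  move=> x; pose D : set (H * C) :=
    [set p | exists s, p = (comb s, dot x (\sum_(q <- s) q.1 *: V0 q.2))].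
  have [||||z zP] := @riesz_graph _ _ D (nrm x * M).
  - by exists [::]; rewrite /comb !big_nil dot0r.
  - move=> c _ _ [r ->] [s ->]; exists (scale_comb c r ++ s).
    by rewrite /comb !big_scale_comb dotDr dotZr.
  - by rewrite mulr_ge0// nrm_ge0.
  - move=> _ [s ->] /=; rewrite (le_trans (cauchy_schwarz _ _))// -mulrA.
    by rewrite ler_wpM2l ?nrm_ge0.
  exists z => a; rewrite (zP (t a, dot x (V0 a)))//.
  by exists [:: (1, a)]; rewrite comb1 big_seq1 scale1r.
have Wbd (x : K) : nrm (W x) <= M * nrm x.
  apply: total_nrm_le => [|s]; first by rewrite mulr_ge0// nrm_ge0.
  have -> : dot (comb s) (W x) = dot (\sum_(p <- s) p.1 *: V0 p.2) x.
    rewrite !dot_suml; apply: eq_bigr => p _; rewrite !dotZl.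
    by rewrite (dotC (W x)) WE -dotC.
  rewrite (le_trans (cauchy_schwarz _ _))// mulrAC ler_wpM2r ?nrm_ge0//.
have [c x y|S SE] := @bounded_operator _ _ _ W M _ Wbd.
  apply: total_dot_inj => a; rewrite dotDr dotZr !(dotC (W _) (t a)) !WE.
  by rewrite dotDl dotZl rmorphD rmorphM/= conjcK.
exists (adjoint S); split.
  by move=> a; apply: dot_inj => x; rewrite adjointPr SE WE.
by apply: adjoint_bound => // x; rewrite SE.
Qed.

(** The Riesz theorem in the first argument turns the form into vectors [V0 a'],
    and the bound in the second argument lets [V0] extend by [ext_op]. *)
Lemma form_op (b : I -> I -> C) (M : R) : 0 <= M ->
  (forall r s, normc (\sum_(p <- r) \sum_(q <- s) p.1^*%C * q.1 * b p.2 q.2)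
     <= M * nrm (comb r) * nrm (comb s)) ->
  exists V : 'B(H), (forall a a', dot (t a) (V (t a')) = b a a') /\
    (forall x, nrm (V x) <= M * nrm x).
Proof.
move=> M0 bd.
have /choice[V0 V0E] : forall a', exists z, forall a, dot (t a) z = b a a'.
  move=> a'; pose D : set (H * C) :=
    [set p | exists r, p = (comb r, \sum_(q <- r) q.1 * (b q.2 a')^*%C)].
  have [||||z zP] := @riesz_graph _ _ D (M * nrm (t a')).
  - by exists [::]; rewrite /comb !big_nil.
  - move=> c _ _ [r ->] [s ->]; exists (scale_comb c r ++ s).
    rewrite /comb big_scale_comb /=; congr (_, _).
    by have /esym := @big_scale_comb C^o (fun u => (b u a')^*%C) c r s.
  - by rewrite mulr_ge0// nrm_ge0.
  - move=> _ [s ->] /=; have := bd s [:: (1, a')]; rewrite comb1 mulrAC.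
    apply: le_trans; rewrite -normc_conj rmorph_sum/= le_eqVlt; apply/orP; left.
    apply/eqP; congr normc; apply: eq_bigr => p _.
    by rewrite big_seq1 mulr1 rmorphM/= conjcK.
  exists z => a; rewrite dotC (zP (t a, (b a a')^*%C)) ?conjcK//.
  by exists [:: (1, a)]; rewrite comb1 big_seq1 mul1r.
have [s|V [VE Vbd]] := @ext_op _ V0 M M0; last first.
  by exists V; split=> // a a'; rewrite VE V0E.
apply: total_nrm_le => [|r]; first by rewrite mulr_ge0// nrm_ge0.
rewrite mulrAC; apply: le_trans (bd r s).
rewrite le_eqVlt; apply/orP; left; apply/eqP; congr normc.
rewrite dot_suml; apply: eq_bigr => p _; rewrite dot_sumr.
by apply: eq_bigr => q _; rewrite dotZl dotZr V0E mulrA.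
Qed.

(** The quadratic form of [T] is continuous in the vectors. *)
Lemma positive_mx_total n (T : 'M['B(H)]_n) :
  (forall s : 'I_n -> seq (C * I),
     0 <= \sum_i \sum_j dot (comb (s i)) (T i j (comb (s j)))) ->
  positive_mx T.
Proof.
move=> h x.
have /choice[M MP] : forall ij : 'I_n * 'I_n, exists M : R,
    0 <= M /\ forall y, nrm (T ij.1 ij.2 y) <= M * nrm y.
  by move=> ij; have [M M0 TM] := op_bound (T ij.1 ij.2); exists M.
pose K i j := M (i, j) * (nrm (x i) + nrm (x j) + 1).
have K0 i j : 0 <= K i j.
  by rewrite mulr_ge0 ?addr_ge0 ?nrm_ge0//; exact: (MP (i, j)).1.
(* If every vector is moved by at most d <= 1, the form moves by at most
   d * k. *)
pose k := \sum_i \sum_j K i j + 1.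
have k0 : 0 < k by rewrite ltr_wpDl// sumr_ge0// => i _; rewrite sumr_ge0.
apply: ge0_approx => e e0; pose d := Num.min 1 (e / k).
have d0 : 0 < d by rewrite lt_min ltr01 divr_gt0.
have d1 : d <= 1 by rewrite ge_min lexx.
have /choice[s sP] : forall i, exists s, nrm (x i - comb s) < d.
  by move=> i; exact: tot.
exists (\sum_i \sum_j dot (comb (s i)) (T i j (comb (s j)))); first exact: h.
rewrite -sumrB (le_trans (normc_sum _ _))//.
have -> : e = e / k * k by rewrite divfK// gt_eqF.
rewrite -[leRHS]mulrC (@le_trans _ _ (k * d))//; last first.
  by rewrite ler_wpM2l ?(ltW k0)// ge_min lexx orbT.
rewrite (@le_trans _ _ ((\sum_i \sum_j K i j) * d))//; last first.
  by rewrite ler_wpM2r ?(ltW d0)// lerDl.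
rewrite mulr_suml ler_sum// => i _; rewrite -sumrB mulr_suml.
rewrite (le_trans (normc_sum _ _))// ler_sum// => j _.
have -> : dot (x i) (T i j (x j)) - dot (comb (s i)) (T i j (comb (s j))) =
    dot (x i - comb (s i)) (T i j (x j)) +
    dot (comb (s i)) (T i j (x j - comb (s j))).
  by rewrite opB dotBl dotBr addrA subrK.
have [M0 TM] := MP (i, j); rewrite /= in TM.
have si : nrm (comb (s i)) <= nrm (x i) + 1.
  rewrite -[comb (s i)](subKr (x i)) (le_trans (nrmB _ _))// lerD2l.
  by rewrite (le_trans (ltW (sP i)))//.
rewrite (le_trans (le_normcD _ _))//.
rewrite (le_trans (lerD (cauchy_schwarz _ _) (cauchy_schwarz _ _)))//.
rewrite (@le_trans _ _ (d * (M (i, j) * nrm (x j)) +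
   (nrm (x i) + 1) * (M (i, j) * d)))//; last first.
  by rewrite /K le_eqVlt; apply/orP; left; apply/eqP; ring.
apply: lerD; apply: ler_pM; rewrite ?nrm_ge0 ?TM ?(ltW (sP _))//.
by rewrite (le_trans (TM _))// ler_wpM2l// ltW.
Qed.

End total_families.

Section tensor_families.
Context {R : realType} {H K HT : hilbertType R} (t : hilbert_tensor H K HT).
Local Notation C := R[i].

Definition tens_pair (a : H * K) : HT := t a.1 a.2.

Lemma tens_total : total tens_pair.
Proof.
move=> x e e0; have : closure [set v | exists n (x : 'I_n -> H) (y : 'I_n -> K),
    v = \sum_i t (x i) (y i)] x by rewrite tens_dense.
have ball_x : nbhs x (ball x e%:C) by apply: nbhsx_ballx; rewrite ltcR.
move=> /(_ _ ball_x) [_ [[n [u [v ->]]]]].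
rewrite -ball_normE/= nrmE ltcR => xe.
exists [seq (1, (u i, v i)) | i <- enum 'I_n]; rewrite /comb big_map big_enum/=.
by under eq_bigr do rewrite scale1r.
Qed.

Lemma dot_tens a b : dot (tens_pair a) (tens_pair b) = dot a.1 b.1 * dot a.2 b.2.
Proof. exact: tens_dot. Qed.

End tensor_families.

Section positive_matrices.
Context {R : realType}.
Local Notation C := R[i].
Local Open Scope sesquilinear_scope.

Definition psd (J : finType) (k : J -> J -> C) :=
  forall c : J -> C, 0 <= \sum_i \sum_j (c i)^*%C * c j * k i j.

(** Diagonalise in a unitary basis: [D] lists the eigenvalues, and the rows [p l]
    are the eigenvectors. *)
Lemma psd_decomposition (J : finType) (k : J -> J -> C) :
  psd k -> (forall i j, k i j = (k j i)^*%C) ->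
  exists (D : 'I_#|J| -> C) (p : 'I_#|J| -> J -> C),
    (forall l, 0 <= D l) /\
    forall i j, k i j = \sum_l D l * ((p l i)^*%C * p l j).
Proof.
move=> kpsd kherm.
pose A : 'M[C]_#|J| := \matrix_(i, j) k (enum_val i) (enum_val j).
have AE i j : k i j = A (enum_rank i) (enum_rank j) by rewrite mxE !enum_rankK.
have Aherm : A \is hermsymmx.
  apply/is_hermitianmxP; rewrite expr0 scale1r; apply/matrixP => i j.
  by rewrite !mxE kherm.
have /orthomx_spectralP AD := hermitian_normalmx Aherm.
have Pu := spectral_unitarymx A.
move: (Pu) AD; rewrite (invmx_unitary Pu) => {Pu}; move: (spectralmx A) (spectral_diag A) => P d Pu AD.
exists (fun l => d 0 l), (fun l i => P l (enum_rank i)); split.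
  move=> l; have -> : d 0 l = (P *m A *m P^t*) l l.
    rewrite AD !mulmxA (unitarymxP Pu) mul1mx -mulmxA (unitarymxP Pu) mulmx1.
    by rewrite !mxE eqxx mulr1n.
  rewrite mxE; have := kpsd (fun i => (P l (enum_rank i))^*%C).
  rewrite exchange_big/=; congr (0 <= _).
  rewrite (reindex (fun i : 'I_#|J| => enum_val i))/=; last exact/onW_bij/enum_val_bij.
  apply: eq_bigr => j _; rewrite !mxE mulr_suml.
  rewrite (reindex (fun i : 'I_#|J| => enum_val i))/=; last exact/onW_bij/enum_val_bij.
  by apply: eq_bigr => i _; rewrite !enum_valK mxE conjcK mulrAC.
move=> i j; rewrite AE AD mul_mx_diag !mxE; apply: eq_bigr => l _.
by rewrite !mxE mulrA (mulrC (d 0 l)).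
Qed.

(** The Schur product theorem.  With [k] written as a nonnegative combination of
    the rank-one matrices of vectors p_l, the form of the product at c is the
    combination of the forms of [f] at the vectors p_l c. *)
Lemma psd_mul (J : finType) (f k : J -> J -> C) :
  psd f -> psd k -> (forall i j, k i j = (k j i)^*%C) ->
  psd (fun i j => f i j * k i j).
Proof.
move=> fpsd kpsd /(psd_decomposition kpsd)[D [p [D0 kE]]] c.
have -> : \sum_i \sum_j (c i)^*%C * c j * (f i j * k i j) =
    \sum_l D l * \sum_i \sum_j (p l i * c i)^*%C * (p l j * c j) * f i j.
  under [RHS]eq_bigr do rewrite mulr_sumr.
  rewrite [RHS]exchange_big/=; apply: eq_bigr => i _.
  under [RHS]eq_bigr do rewrite mulr_sumr.
  rewrite [RHS]exchange_big/=; apply: eq_bigr => j _.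
  rewrite kE !mulr_sumr; apply: eq_bigr => l _.
  by rewrite rmorphM/=; ring.
by rewrite sumr_ge0// => l _; rewrite mulr_ge0.
Qed.

End positive_matrices.

(** * Riemann sums for integrals against complex measures *)

Section finite_partitions.
Context {d : measure_display} {T : measurableType d} {R : realType}.
Local Notation C := R[i].

(** A finite measurable partition is encoded by its labelling map, which makes
    the pieces disjoint and covering by construction.  Throughout, [q] is such a
    map and [p l] a sample point for the label [l], so that Riemann sums are
    indexed by labels. *)
Definition measurable_fibers (L : finType) (q : T -> L) :=
  forall l, measurable (q @^-1` [set l]).

Lemma measurable_fibers_ffun (J L : finType) (q : J -> T -> L) :
  (forall j, measurable_fibers (q j)) ->
  measurable_fibers (fun x => [ffun j => q j x]).
Proof.
move=> mq l; rewrite (_ : _ @^-1` _ = \bigcap_(j in [set: J]) (q j @^-1` [set l j])).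
  by apply: fin_bigcap_measurable => [|j _]; [exact: finite_finset|exact: mq].
apply/seteqP; split=> x /= => [<- j _|h]; first by rewrite /= ffunE.
by apply/ffunP => j; rewrite ffunE; exact: h.
Qed.

(** The labels are the integer parts of (f_j + M) / e. *)
Lemma fine_partition_real (J : finType) (f : J -> T -> R) (M e : R) : 0 < e ->
  (forall j, measurable_fun [set: T] (f j)) ->
  (forall j x, `|f j x| <= M) ->
  exists (L : finType) (q : T -> L), measurable_fibers q /\
    forall j x y, q x = q y -> `|f j x - f j y| <= e.
Proof.
move=> e0 mf bf; pose N := Num.truncn ((M + M) / e).
pose k j x := Num.truncn ((f j x + M) / e).
have fM0 j x : 0 <= (f j x + M) / e.
  rewrite divr_ge0 ?(ltW e0)//; have := bf j x; rewrite ler_norml => /andP[+ _].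
  by lra.
have kN j x : (k j x < N.+1)%N.
  rewrite ltnS; apply: le_truncn; rewrite ler_pM2r ?invr_gt0// lerD2r.
  by rewrite (le_trans (ler_norm _)).
exists {ffun J -> 'I_N.+1}, (fun x => [ffun j => inord (k j x)]); split.
  apply: measurable_fibers_ffun => j l.
  rewrite (_ : _ @^-1` _ = [set: T] `&` f j @^-1` `[l%:R * e - M, l.+1%:R * e - M[).
    exact: mf.
  apply/seteqP; split=> x /=; rewrite in_itv/=.
    move=> /(congr1 val)/=; rewrite inordK// => kl; split=> //.
    have := truncn_itv (fM0 j x); rewrite -/(k j x) kl.
    by rewrite ler_pdivlMr// ltr_pdivrMr// lerBlDr ltrBrDr.
  move=> [_]; rewrite lerBlDr ltrBrDr -ler_pdivlMr// -ltr_pdivrMr// => h.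
  by apply: val_inj; rewrite /= inordK// /k; apply: truncn_def.
move=> j x y /ffunP/(_ j); rewrite !ffunE => /(congr1 val)/=; rewrite !inordK// => kxy.
have := truncn_itv (fM0 j x); have := truncn_itv (fM0 j y).
rewrite -!/(k j _) kxy !ler_pdivlMr// !ltr_pdivrMr// -!natr1.
by rewrite ler_norml; move: (_%:R) => n; lra.
Qed.

Definition bounded_measurable (f : T -> C) :=
  [/\ measurable_fun [set: T] (fun x => complex.Re (f x)),
      measurable_fun [set: T] (fun x => complex.Im (f x)) &
      exists M : R, forall x, normc (f x) <= M].

(** One partition serves a finite family of functions at once, which is what
    allows relations between several integrals to be checked on Riemann sums.
    The point [x0] is the sample point of empty pieces. *)
Lemma fine_partition (x0 : T) (J : finType) (f : J -> T -> C) (e : R) : 0 < e ->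
  (forall j, bounded_measurable (f j)) ->
  exists (L : finType) (q : T -> L) (p : L -> T), measurable_fibers q /\
    forall j x, normc (f j x - f j (p (q x))) <= e.
Proof.
move=> e0 mf; have /choice[M MP] : forall j, exists M : R, forall x, normc (f j x) <= M.
  by move=> j; have [_ _] := mf j.
pose F (jb : J * bool) x := if jb.2 then complex.Re (f jb.1 x) else complex.Im (f jb.1 x).
have [||[j b] x|L [q [mq qF]]] := @fine_partition_real _ F (\sum_j `|M j|) (e / 2).
- by rewrite divr_gt0.
- by move=> [j []]; have [] := mf j.
- have h : normc (f j x) <= \sum_j `|M j|.
    rewrite (bigD1 j)//= (le_trans (MP j x))// (le_trans (ler_norm _))// lerDl.
    by rewrite sumr_ge0.
  by case: b; rewrite (le_trans _ h)// ?normc_le_Re ?normc_le_Im.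
have /choice[p pP] : forall l, exists y, forall x, q x = l -> q y = l.
  move=> l; have [[y yl]|h] := pselect (exists y, q y = l); first by exists y.
  by exists x0 => x xl; exfalso; apply: h; exists x.
exists L, q, p; split=> // j x; rewrite (le_trans (normc_le _))//.
have qp : q x = q (p (q x)) by rewrite (pP _ x).
have := qF (j, true) _ _ qp; have := qF (j, false) _ _ qp; rewrite /F/=.
by move=> h1 h2; rewrite ReB ImB (splitr e) lerD.
Qed.

Let sum_indic_integral (mu : {finite_measure set T -> \bar R}) (I : Type)
    (r : seq I) (A : I -> set T) (c : I -> R) : (forall i, measurable (A i)) ->
  mu.-integrable setT (EFin \o (fun x => \sum_(i <- r) c i * \1_(A i) x)) /\
  \int[mu]_x (\sum_(i <- r) c i * \1_(A i) x) = \sum_(i <- r) c i * fine (mu (A i)).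
Proof.
move=> mA; elim: r => [|i r [ir IH]].
  split; last by rewrite big_nil; under eq_Rintegral do rewrite big_nil;
    rewrite Rintegral_cst// mul0r.
  by rewrite (_ : _ \o _ = cst 0%E) ?integrable0//; apply/funext => x /=; rewrite big_nil.
have i1 : mu.-integrable setT (EFin \o \1_(A i)) by exact: integrable_indic.
have ic : mu.-integrable setT (EFin \o (fun x => c i * \1_(A i) x)).
  by have := integrableZl measurableT (c i) i1.
split.
  have := integrableD measurableT ic ir; congr (_.-integrable _ _).
  by apply/funext => x /=; rewrite big_cons.
under eq_Rintegral do rewrite big_cons.
rewrite big_cons RintegralD// IH RintegralZl//.
by rewrite /Rintegral integral_indic// setIT.
Qed.

(** Boundedness of [f], hence integrability, follows from its closeness to the
    step function, which has finitely many values. *)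
Lemma Rintegral_approx (mu : {finite_measure set T -> \bar R}) (L : finType)
    (q : T -> L) (p : L -> T) (f : T -> R) (e : R) :
  measurable_fibers q -> measurable_fun [set: T] f ->
  (forall x, `|f x - f (p (q x))| <= e) ->
  `|\int[mu]_x f x - \sum_l f (p l) * fine (mu (q @^-1` [set l]))|
    <= e * fine (mu setT).
Proof.
move=> mq mf fe.
have [ic <-] := @sum_indic_integral mu L (index_enum L)
  (fun l => q @^-1` [set l]) (fun l => f (p l)) mq.
have sE x : \sum_l f (p l) * \1_(q @^-1` [set l]) x = f (p (q x)).
  rewrite (bigD1 (q x))//= indicE mem_set// mulr1 big1 ?addr0// => l lq.
  by rewrite indicE memNset ?mulr0//= => /esym/eqP; exact/negP.
have intf : mu.-integrable setT (EFin \o f).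
  apply: measurable_bounded_integrable => //.
    by rewrite ltey_eq fin_num_measure.
  pose M := \sum_l `|f (p l)| + e.
  exists M; split; first exact: num_real.
  move=> y My x _; apply: le_trans (ltW My).
  rewrite /= -[f x](subrK (f (p (q x)))) (le_trans (ler_normD _ _))//.
  rewrite /M addrC lerD// (bigD1 (q x))//= lerDl sumr_ge0//.
rewrite -RintegralB//.
have intB : mu.-integrable setT (EFin \o (fun x => f x -
    \sum_l f (p l) * \1_(q @^-1` [set l]) x)).
  exact: (integrableB measurableT intf ic).
rewrite (le_trans (le_normr_Rintegral _ intB))//.
rewrite -Rintegral_cst//; apply: le_Rintegral => //.
- exact: (integrable_norm intB).
- exact: finite_measure_integrable_cst.
- by move=> x _; rewrite sE.
Qed.

(** [K] is the total variation of the charge. *)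
Lemma charge_integral_approx (nu : {charge set T -> \bar R}) :
  exists2 K : R, 0 <= K & forall (L : finType) (q : T -> L) (p : L -> T)
    (f : T -> R) (e : R),
    measurable_fibers q -> measurable_fun [set: T] f ->
    (forall x, `|f x - f (p (q x))| <= e) ->
    `|charge_integral nu f - \sum_l f (p l) * fine (nu (q @^-1` [set l]))|
      <= K * e.
Proof.
rewrite /charge_integral; set P := cid _; set N := cid (svalP P).
set mp := jordan_pos _; set mn := jordan_neg _.
exists (fine (mp setT) + fine (mn setT)).
  by rewrite addr_ge0// fine_ge0.
move=> L q p f e mq mf fe.
have hp := @Rintegral_approx mp L q p f e mq mf fe.
have hn := @Rintegral_approx mn L q p f e mq mf fe.
have -> : \sum_l f (p l) * fine (nu (q @^-1` [set l])) =
   \sum_l f (p l) * fine (mp (q @^-1` [set l])) -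
   \sum_l f (p l) * fine (mn (q @^-1` [set l])).
  rewrite -sumrB; apply: eq_bigr => l _.
  rewrite (jordan_decomp (svalP N) (mq l)) -/mp -/mn /cadd/= cscaleN1.
  by rewrite fineB ?fin_num_measure// mulrBr.
rewrite (_ : _ - _ - _ = (\int[mp]_x f x - \sum_l f (p l) * fine (mp (q @^-1` [set l]))) -
  (\int[mn]_x f x - \sum_l f (p l) * fine (mn (q @^-1` [set l])))); last by ring.
by rewrite (le_trans (ler_normB _ _))// mulrC mulrDr lerD.
Qed.

Lemma complex_integral_approx (nu mu : {charge set T -> \bar R}) :
  exists2 K : R, 0 <= K & forall (L : finType) (q : T -> L) (p : L -> T)
    (f : T -> C) (e : R),
    measurable_fibers q -> bounded_measurable f ->
    (forall x, normc (f x - f (p (q x))) <= e) ->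
    normc (complex_integral nu mu f - \sum_l f (p l) *
      (fine (nu (q @^-1` [set l])) +i* fine (mu (q @^-1` [set l]))))
      <= K * e.
Proof.
have [K K0 KP] := charge_integral_approx nu.
have [K' K'0 K'P] := charge_integral_approx mu.
exists (2 * (K + K')); first by rewrite mulr_ge0// addr_ge0.
move=> L q p f e mq [mre mim _] fe.
have fre x : `|complex.Re (f x) - complex.Re (f (p (q x)))| <= e.
  by rewrite -ReB (le_trans (normc_le_Re _)).
have fim x : `|complex.Im (f x) - complex.Im (f (p (q x)))| <= e.
  by rewrite -ImB (le_trans (normc_le_Im _)).
have h1 := KP _ _ _ _ _ mq mre fre; have h2 := KP _ _ _ _ _ mq mim fim.
have h3 := K'P _ _ _ _ _ mq mre fre; have h4 := K'P _ _ _ _ _ mq mim fim.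
have sumE (F : L -> R) (G : L -> R) :
    \sum_l (F l +i* G l) = (\sum_l F l) +i* (\sum_l G l).
  by elim/big_rec3: _ => //= l x y z _ ->.
rewrite (le_trans (normc_le _))//.
have -> : \sum_l f (p l) * (fine (nu (q @^-1` [set l])) +i* fine (mu (q @^-1` [set l]))) =
  \sum_l ((complex.Re (f (p l)) * fine (nu (q @^-1` [set l])) -
           complex.Im (f (p l)) * fine (mu (q @^-1` [set l]))) +i*
          (complex.Re (f (p l)) * fine (mu (q @^-1` [set l])) +
           complex.Im (f (p l)) * fine (nu (q @^-1` [set l])))).
  by apply: eq_bigr => l _; case: (f (p l)).
rewrite sumE sumrB big_split/=.
move: h1 h2 h3 h4; rewrite !ler_norml.
move: (\sum_l _) (\sum_l _) (\sum_l _) (\sum_l _) (charge_integral _ _) (charge_integral _ _)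
   (charge_integral _ _) (charge_integral _ _) => a b c d' i1 i2 i3 i4.
move=> /andP[? ?] /andP[? ?] /andP[? ?] /andP[? ?].
rewrite (_ : 2 * (K + K') * e = (K * e + K' * e) + (K * e + K' * e)); last by ring.
by apply: lerD; rewrite ler_norml; apply/andP; split; lra.
Qed.

End finite_partitions.

(** * Integrals against an operator-valued measure *)

Section borel_functions.
Context {R : realType} {G : topologicalGroupType}.
Local Notation C := R[i].

Definition bounded_borel (f : G -> C) := bounded_measurable (f : Bor G -> C).

Lemma open_borel (A : set G) : open A -> measurable (A : set (Bor G)).
Proof. by move=> oA; apply: sub_sigma_algebra. Qed.

Lemma continuous_borel (f : G -> R) :
  (forall g e, 0 < e -> \forall h \near g, `|f h - f g| < e) ->
  measurable_fun [set: Bor G] (f : Bor G -> R).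
Proof.
move=> cf; apply: (measurability _ (RGenOInfty.measurableE R)) => //.
move=> _ [_ [a ->] <-]; rewrite setTI preimage_itvoy.
have oA : open [set g : G | a < f g].
  rewrite openE => g /= ag; have fa : 0 < f g - a by rewrite subr_gt0.
  by apply: filterS (cf g _ fa) => h /=; rewrite ltr_norml => /andP[+ _]; lra.
exact: open_borel oA.
Qed.

Lemma bounded_borel_cst c : bounded_borel (fun=> c).
Proof. by split; [exact: measurable_cst|exact: measurable_cst|exists (normc c)]. Qed.

Lemma bounded_borelD f g : bounded_borel f -> bounded_borel g ->
  bounded_borel (fun x => f x + g x).
Proof.
move=> [fr fi [M fM]] [gr gi [N gN]]; split.
- rewrite (_ : (fun _ => _) = (fun x : Bor G => complex.Re (f x) + complex.Re (g x))).
    exact: measurable_funD.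
  by apply/funext => x; rewrite ReD.
- rewrite (_ : (fun _ => _) = (fun x : Bor G => complex.Im (f x) + complex.Im (g x))).
    exact: measurable_funD.
  by apply/funext => x; case: (f x) (g x) => [? ?] [? ?].
- by exists (M + N) => x; rewrite (le_trans (le_normcD _ _))// lerD.
Qed.

Lemma bounded_borelM f g : bounded_borel f -> bounded_borel g ->
  bounded_borel (fun x => f x * g x).
Proof.
move=> [fr fi [M fM]] [gr gi [N gN]]; split.
- rewrite (_ : (fun _ => _) = (fun x : Bor G =>
      complex.Re (f x) * complex.Re (g x) - complex.Im (f x) * complex.Im (g x))).
    by apply: measurable_funB; exact: measurable_funM.
  by apply/funext => x; case: (f x) (g x) => [? ?] [? ?].
- rewrite (_ : (fun _ => _) = (fun x : Bor G =>
      complex.Re (f x) * complex.Im (g x) + complex.Im (f x) * complex.Re (g x))).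
    by apply: measurable_funD; exact: measurable_funM.
  by apply/funext => x; case: (f x) (g x) => [? ?] [? ?].
- by exists (M * N) => x; rewrite normcM ler_pM ?normc_ge0.
Qed.

Lemma bounded_borel_conj f : bounded_borel f -> bounded_borel (fun x => (f x)^*%C).
Proof.
move=> [fr fi [M fM]]; split.
- rewrite (_ : (fun _ => _) = (fun x : Bor G => complex.Re (f x)))//.
  by apply/funext => x; rewrite ReJ.
- rewrite (_ : (fun _ => _) = (fun x : Bor G => - complex.Im (f x))).
    exact: measurable_funN.
  by apply/funext => x; case: (f x).
- by exists M => x; rewrite normc_conj.
Qed.

Lemma bounded_borel_sum (I : Type) (s : seq I) (f : I -> G -> C) :
  (forall i, bounded_borel (f i)) -> bounded_borel (fun x => \sum_(i <- s) f i x).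
Proof.
move=> bf; elim: s => [|i s IH].
  rewrite (_ : (fun _ => _) = fun=> 0); first exact: bounded_borel_cst.
  by apply/funext => x; rewrite big_nil.
rewrite (_ : (fun _ => _) = fun x => f i x + \sum_(j <- s) f j x).
  exact: bounded_borelD.
by apply/funext => x; rewrite big_cons.
Qed.

Lemma bounded_borel_indic (A : set (Bor G)) : measurable A ->
  bounded_borel (fun x => (\1_A x : R)%:C).
Proof.
move=> mA; split; [exact: measurable_indic|exact: measurable_cst|].
by exists 1 => x; rewrite normcR indicE; case: (_ \in _); rewrite ?normr1 ?normr0.
Qed.

(** Continuity with values in a Hilbert space, with real error bounds in place of
    complex ones. *)
Definition vcontinuous (H : hilbertType R) (u : G -> H) :=
  forall g (e : R), 0 < e -> \forall h \near g, nrm (u h - u g) < e.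

Lemma vcontinuous_op (H : hilbertType R) (u : G -> H) (T : 'B(H)) :
  vcontinuous u -> vcontinuous (fun g => T (u g)).
Proof.
move=> cu g e e0; have [M M0 TM] := op_bound T.
have M1 : 0 < M + 1 by rewrite ltr_wpDl.
have := cu g (e / (M + 1)) ltac:(by rewrite divr_gt0).
apply: filterS => h; rewrite ltr_pdivlMr// -opB => uh.
have := TM (u h - u g); have := nrm_ge0 (u h - u g); move: uh.
by move: (nrm _) (nrm _) => a b; nra.
Qed.

Lemma bounded_borel_dot (H : hilbertType R) (u v : G -> H) (M N : R) :
  vcontinuous u -> vcontinuous v ->
  (forall g, nrm (u g) <= M) -> (forall g, nrm (v g) <= N) ->
  bounded_borel (fun g => dot (u g) (v g)).
Proof.
move=> cu cv uM vN.
have M0 : 0 <= M by rewrite (le_trans (nrm_ge0 _) (uM 1%g)).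
have N0 : 0 <= N by rewrite (le_trans (nrm_ge0 _) (vN 1%g)).
have k0 : 0 < M + N + 1 by rewrite ltr_wpDl// addr_ge0.
have cuv g e : 0 < e -> \forall h \near g,
    normc (dot (u h) (v h) - dot (u g) (v g)) < e.
  move=> e0; have d0 : 0 < e / (M + N + 1) by rewrite divr_gt0.
  apply: filterS (filterI (cu g _ d0) (cv g _ d0)) => h [uh vh].
  have -> : dot (u h) (v h) - dot (u g) (v g) =
      dot (u h - u g) (v h) + dot (u g) (v h - v g).
    by rewrite dotBl dotBr addrA subrK.
  rewrite (le_lt_trans (le_normcD _ _))//.
  rewrite (le_lt_trans (lerD (cauchy_schwarz _ _) (cauchy_schwarz _ _)))//.
  have := ler_pM (nrm_ge0 _) (nrm_ge0 _) (ltW uh) (vN h).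
  have := ler_pM (nrm_ge0 _) (nrm_ge0 _) (uM g) (ltW vh).
  have : e / (M + N + 1) * (M + N + 1) = e by rewrite divfK// gt_eqF.
  by move: d0; move: (e / _) => d d0; lra.
split.
- apply: continuous_borel => g e e0; apply: filterS (cuv g _ e0) => h.
  by rewrite -ReB; exact: le_lt_trans (normc_le_Re _).
- apply: continuous_borel => g e e0; apply: filterS (cuv g _ e0) => h.
  by rewrite -ImB; exact: le_lt_trans (normc_le_Im _).
- exists (M * N) => g; rewrite (le_trans (cauchy_schwarz _ _))//.
  by rewrite ler_pM ?nrm_ge0.
Qed.

End borel_functions.

Section povm_integrals.
Context {R : realType} {G : topologicalGroupType} {H : hilbertType R}.
Variable E : povm G H.
Local Notation C := R[i].
Implicit Types (x y : H) (f : G -> C).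

Lemma povm_integral_approx x y :
  exists K : R, 0 <= K /\ forall (L : finType) (q : G -> L) (p : L -> G) f (e : R),
    measurable_fibers (q : Bor G -> L) -> bounded_borel f ->
    (forall g, normc (f g - f (p (q g))) <= e) ->
    normc (povm_integral E x y f -
           \sum_l f (p l) * dot x (E (q @^-1` [set l]) y)) <= K * e.
Proof.
have [K K0 KP] := @complex_integral_approx _ (Bor G) R (povm_re E x y) (povm_im E x y).
exists K; split=> // L q p f e mq mf fe; rewrite /povm_integral.
have := KP L q p f e mq mf fe; congr (normc (_ - _) <= _).
by apply: eq_bigr => l _; rewrite /povm_re /povm_im/=; case: (dot _ _).
Qed.

(** Positivity of a linear combination of integrals can be tested on Riemann
    sums that use one common partition: this reduces every property of the
    integral used below to finite sums. *)
Lemma povm_integrals_ge0 (J : finType) (c : J -> C) (x y : J -> H)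
    (f : J -> G -> C) : (forall j, bounded_borel (f j)) ->
  (forall (L : finType) (q : G -> L) (p : L -> G),
    measurable_fibers (q : Bor G -> L) ->
    0 <= \sum_j c j * \sum_l f j (p l) * dot (x j) (E (q @^-1` [set l]) (y j))) ->
  0 <= \sum_j c j * povm_integral E (x j) (y j) (f j).
Proof.
move=> bf h; apply: ge0_approx => e e0.
have /choice[K KP] := fun j => povm_integral_approx (x j) (y j).
pose k := \sum_j normc (c j) * K j + 1.
have k0 : 0 < k.
  by rewrite ltr_wpDl// sumr_ge0// => j _; rewrite mulr_ge0 ?normc_ge0//; have [] := KP j.
have d0 : 0 < e / k by rewrite divr_gt0.
have [L [q [p [mq fq]]]] := fine_partition (1%g : Bor G) d0 bf.
exists (\sum_j c j * \sum_l f j (p l) * dot (x j) (E (q @^-1` [set l]) (y j))).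
  exact: h.
rewrite -sumrB (le_trans (normc_sum _ _))//.
rewrite (@le_trans _ _ (\sum_j normc (c j) * K j * (e / k)))//.
  apply: ler_sum => j _; rewrite -mulrBr normcM -mulrA ler_wpM2l ?normc_ge0//.
  by have [_] := KP j; apply=> //; exact: bf.
rewrite -mulr_suml (@le_trans _ _ (k * (e / k)))//.
  by rewrite ler_wpM2r ?(ltW d0)// /k lerDl.
by rewrite mulrC divfK// gt_eqF.
Qed.

Lemma povm_integrals_eq0 (J : finType) (c : J -> C) (x y : J -> H)
    (f : J -> G -> C) : (forall j, bounded_borel (f j)) ->
  (forall (L : finType) (q : G -> L) (p : L -> G),
    measurable_fibers (q : Bor G -> L) ->
    \sum_j c j * \sum_l f j (p l) * dot (x j) (E (q @^-1` [set l]) (y j)) = 0) ->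
  \sum_j c j * povm_integral E (x j) (y j) (f j) = 0.
Proof.
move=> bf h; apply/le_anti/andP; split; last first.
  by apply: povm_integrals_ge0 => // L q p mq; rewrite h.
rewrite -oppr_ge0 -sumrN; under eq_bigr do rewrite -mulNr.
apply: povm_integrals_ge0 => // L q p mq.
by under eq_bigr do rewrite mulNr; rewrite sumrN h// oppr0.
Qed.

(** The relation to be shown is one between Riemann sums of the [f j] and of
    their combination, which is adjoined to the family as the extra index. *)
Lemma povm_integral_sum (J : finType) x y (c : J -> C) (f : J -> G -> C) :
  (forall j, bounded_borel (f j)) ->
  povm_integral E x y (fun g => \sum_j c j * f j g) =
  \sum_j c j * povm_integral E x y (f j).
Proof.
move=> bf; apply/esym/subr0_eq.
pose F (j : J + unit) : G -> C := match j with
  | inl j => f j | inr _ => fun g => \sum_j c j * f j g end.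
pose d (j : J + unit) := match j with inl j => c j | inr _ => -1 end.
have := @povm_integrals_eq0 (J + unit)%type d (fun=> x) (fun=> y) F.
rewrite big_sumType/= (big_pred1 tt) ?mulN1r; last by case.
apply.
  case=> [j|u]; first exact: bf.
  by apply: bounded_borel_sum => j; apply: bounded_borelM => //; exact: bounded_borel_cst.
move=> L q p mq; rewrite big_sumType/= (big_pred1 tt) ?mulN1r; last by case.
rewrite -[X in _ - X]/(\sum_l (\sum_j c j * f j (p l)) * _) -[RHS](subrr
  (\sum_j c j * \sum_l f j (p l) * dot x (E (q @^-1` [set l]) y))).
congr (_ - _); under eq_bigr do rewrite mulr_suml.
rewrite exchange_big/=; apply: eq_bigr => j _; rewrite mulr_sumr.
by apply: eq_bigr => l _; rewrite mulrA.
Qed.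

Lemma povm_integral_linear x y (c : C) f1 f2 :
  bounded_borel f1 -> bounded_borel f2 ->
  povm_integral E x y (fun g => c * f1 g + f2 g) =
  c * povm_integral E x y f1 + povm_integral E x y f2.
Proof.
move=> b1 b2; have := @povm_integral_sum bool x y (fun b => if b then c else 1)
  (fun b => if b then f1 else f2).
rewrite big_bool mul1r => <-; last by case.
by congr povm_integral; apply/funext => g; rewrite big_bool mul1r.
Qed.

(** The values of the measure are the matrix coefficients of self-adjoint
    operators. *)
Lemma povm_integral_conj x y f : bounded_borel f ->
  povm_integral E y x (fun g => (f g)^*%C) = (povm_integral E x y f)^*%C.
Proof.
move=> bf; apply: eq_approx => e e0.
have [K [K0 KP]] := povm_integral_approx x y.
have [K' [K'0 K'P]] := povm_integral_approx y x.
have k0 : 0 < K + K' + 1 by rewrite ltr_wpDl// addr_ge0.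
have d0 : 0 < e / (K + K' + 1) by rewrite divr_gt0.
have [L [q [p [mq fq]]]] := @fine_partition _ _ _ (1%g : Bor G) unit (fun=> f)
  _ d0 (fun=> bf).
have h1 := KP _ _ _ _ _ mq bf (fq tt).
have := K'P _ q p _ (e / (K + K' + 1)) mq (bounded_borel_conj bf).
have -> : \sum_l (f (p l))^*%C * dot y (E (q @^-1` [set l]) x) =
   (\sum_l f (p l) * dot x (E (q @^-1` [set l]) y))^*%C.
  rewrite rmorph_sum; apply: eq_bigr => l _; rewrite rmorphM/=; congr (_ * _).
  by rewrite positive_op_herm//; exact: povm_ge0.
set S := \sum_l _ in h1 *.
move=> h2; have {}h2 := h2 (fun g => _).
have -> : povm_integral E y x (fun g => (f g)^*%C) - (povm_integral E x y f)^*%C =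
  (povm_integral E y x (fun g => (f g)^*%C) - S^*%C) - (povm_integral E x y f - S)^*%C.
  by rewrite rmorphB/=; ring.
rewrite (le_trans (le_normcD _ _))// normcN normc_conj.
rewrite (le_trans (lerD (h2 _) h1))//.
  by move=> g; rewrite -rmorphB normc_conj; exact: fq tt g.
have : e / (K + K' + 1) * (K + K' + 1) = e by rewrite divfK// gt_eqF.
by move: d0; move: (e / _) => d d0; lra.
Qed.

Lemma povm_integral_cst x y c : povm_integral E x y (fun=> c) = c * dot x y.
Proof.
have [K [K0 KP]] := povm_integral_approx x y.
apply/subr0_eq/eq0_normc/le_anti; rewrite normc_ge0 andbT.
have := KP unit (fun=> tt) (fun=> 1%g) (fun=> c) 0.
rewrite (big_pred1 tt); last by case.
rewrite (_ : _ @^-1` _ = setT) ?povmT ?mulr0; last by apply/seteqP; split.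
apply=> [l|//|g]; [|exact: bounded_borel_cst|by rewrite subrr normc0].
by rewrite (_ : _ @^-1` _ = setT)//; apply/seteqP; split => // g _; case: l.
Qed.

Lemma povm_integral_indic x y (A : set (Bor G)) : measurable A ->
  povm_integral E x y (fun g => (\1_A g : R)%:C) = dot x (E A y).
Proof.
move=> mA; have [K [K0 KP]] := povm_integral_approx x y.
apply/subr0_eq/eq0_normc/le_anti; rewrite normc_ge0 andbT.
have [->|/set0P[a Aa]] := eqVneq A set0.
  rewrite (_ : (fun _ => _) = fun=> 0); last by apply/funext => g; rewrite indic0.
  by rewrite povm_integral_cst povm0 mul0r dot0r subrr normc0.
have /choice[p pP] : forall b : bool, exists g, forall h, (h \in A) = b -> (g \in A) = b.
  move=> b; have [[h hb]|hb] := pselect (exists h, (h \in A) = b); first by exists h.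
  by exists 1%g => h hA; exfalso; apply: hb; exists h.
have := KP bool (fun g => g \in A) p _ 0 _ (bounded_borel_indic mA).
rewrite big_bool -[X in _ - X]/(_ + _) !indicE (pP true a (mem_set Aa)).
have -> : ((p false \in A)%:R%:C : C) * dot x (E ((fun g => g \in A) @^-1` [set false]) y) = 0.
  have [pA|_] := boolP (p false \in A); last by rewrite mul0r.
  rewrite (_ : _ @^-1` _ = set0) ?povm0 ?dot0r ?mulr0//.
  apply/seteqP; split=> // h /= hA; have := pP false h hA.
  by rewrite pA.
rewrite (_ : _ @^-1` [set true] = A); last first.
  by apply/seteqP; split=> h /=; [exact: set_mem|exact: mem_set].
rewrite mul1r addr0 mulr0; apply=> [b|g]; last first.
  by rewrite !indicE (pP (g \in A) g erefl) subrr normc0.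
case: b; first by rewrite (_ : _ @^-1` _ = A)//;
  apply/seteqP; split=> h /=; [exact: set_mem|exact: mem_set].
rewrite (_ : _ @^-1` _ = ~` A); first exact: measurableC.
apply/seteqP; split=> h /=; last by move=> hA; rewrite memNset.
by move=> hA /mem_set; rewrite hA.
Qed.

(** The Schur product theorem applied cell by cell: the matrix of measures
    <eta_i, E(A) eta_j> and the matrix of functions are both positive
    semidefinite. *)
Lemma povm_integral_psd (J : finType) (eta : J -> H) (f : J -> J -> G -> C) :
  (forall i j, bounded_borel (f i j)) ->
  (forall g, psd (fun i j => f i j g)) ->
  psd (fun i j => povm_integral E (eta i) (eta j) (f i j)).
Proof.
move=> bf fpsd c; rewrite pair_bigA/=.
have := @povm_integrals_ge0 (J * J)%type (fun ij => (c ij.1)^*%C * c ij.2)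
  (fun ij => eta ij.1) (fun ij => eta ij.2) (fun ij => f ij.1 ij.2).
apply=> // L q p mq.
have -> : \sum_j (c j.1)^*%C * c j.2 * \sum_l f j.1 j.2 (p l) *
      dot (eta j.1) (E (q @^-1` [set l]) (eta j.2)) =
  \sum_l \sum_i \sum_j (c i)^*%C * c j *
      (f i j (p l) * dot (eta i) (E (q @^-1` [set l]) (eta j))).
  under [RHS]eq_bigr do rewrite pair_bigA/=.
  rewrite exchange_big/=; apply: eq_bigr => ij _; rewrite mulr_sumr.
  by [].
apply: sumr_ge0 => l _.
have kpsd : psd (fun i j => dot (eta i) (E (q @^-1` [set l]) (eta j))).
  move=> b; have := povm_ge0 E (mq l) (\sum_i b i *: eta i).
  rewrite dot_suml op_sum; congr (0 <= _); apply: eq_bigr => i _.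
  rewrite dot_sumr; apply: eq_bigr => j _.
  by rewrite opZ dotZl dotZr mulrA.
apply: (psd_mul (fpsd (p l)) kpsd _ c) => i j.
by apply: positive_op_herm; exact: povm_ge0.
Qed.

Lemma povm_integral_ge0 x f : bounded_borel f -> (forall g, 0 <= f g) ->
  0 <= povm_integral E x x f.
Proof.
move=> bf f0.
have := @povm_integral_psd unit (fun=> x) (fun _ _ => f) (fun _ _ => bf).
move=> /(_ _ (fun=> 1)); rewrite !(big_pred1 tt) ?conjc1 ?mul1r; try by case.
apply=> g c; rewrite !(big_pred1 tt); try by case.
by rewrite mulr_ge0// mulJc ler0c sqr_ge0.
Qed.

End povm_integrals.

(** * The relativization map: algebraic properties *)

Section positive_kernels.
Context {R : realType}.
Local Notation C := R[i].

(** Positivity on lists rather than finite types: concatenated and flattened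
    lists then serve as block matrices. *)
Definition psd_kernel (A : Type) (k : A -> A -> C) := forall s : seq (C * A),
  0 <= \sum_(p <- s) \sum_(q <- s) p.1^*%C * q.1 * k p.2 q.2.

Lemma psd_kernel_psd (A : Type) (k : A -> A -> C) (J : finType) (a : J -> A) :
  psd_kernel k -> psd (fun i j => k (a i) (a j)).
Proof.
move=> kpsd c; have := kpsd [seq (c i, a i) | i <- enum J].
rewrite big_map big_enum/=; congr (0 <= _); apply: eq_bigr => i _.
by rewrite big_map big_enum/=.
Qed.

Lemma gram_psd_kernel (H : hilbertType R) (A : Type) (z : A -> H) :
  psd_kernel (fun a b => dot (z a) (z b)).
Proof. by move=> s; rewrite -dot_comb dotxx_ge0. Qed.

Lemma povm_integral_psd_kernel (G : topologicalGroupType) (H : hilbertType R)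
    (E : povm G H) (A : Type) (eta : A -> H) (f : A -> A -> G -> C) :
  (forall a b, bounded_borel (f a b)) ->
  (forall g, psd_kernel (fun a b => f a b g)) ->
  psd_kernel (fun a b => povm_integral E (eta a) (eta b) (f a b)).
Proof.
move=> bf fpsd s; rewrite big_tnth; under eq_bigr do rewrite big_tnth.
pose a i := (tnth (in_tuple s) i).2.
apply: (@povm_integral_psd _ _ _ E _ (eta \o a) (fun i j => f (a i) (a j))).
  by move=> i j; exact: bf.
by move=> g; apply: (psd_kernel_psd (k := fun a b => f a b g)); exact: fpsd.
Qed.

End positive_kernels.

Section representations.
Context {R : realType} {G : topologicalGroupType} {H : hilbertType R}.
Variable U : unitary_rep G H.
Implicit Types (g h : G) (x y : H).

Lemma rep_adjK g x : U g (adjoint (U g) x) = x.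
Proof. by have /(congr1 (fun T : 'B(H) => T x)) := rep_unitaryr U g. Qed.

Lemma adj_repK g x : adjoint (U g) (U g x) = x.
Proof. by have /(congr1 (fun T : 'B(H) => T x)) := rep_unitaryl U g. Qed.

(** Continuity is given for [U g]; it passes to the adjoint through inversion in
    the group. *)
Lemma adj_rep g x : adjoint (U g) x = U g^-1%g x.
Proof.
have UV : U g (U g^-1%g x) = x.
  by have := repM U g g^-1%g; rewrite mulgV rep1 => /(congr1 (fun T : 'B(H) => T x)).
by rewrite -{1}UV adj_repK.
Qed.

Lemma adj_repM g h x : adjoint (U (g * h)%g) x = adjoint (U h) (adjoint (U g) x).
Proof. by rewrite !adj_rep invgM repM. Qed.

Lemma dot_rep g x y : dot (U g x) (U g y) = dot x y.
Proof. by rewrite -adjointP adj_repK. Qed.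

Lemma dot_adj_rep g x y : dot (adjoint (U g) x) (adjoint (U g) y) = dot x y.
Proof. by rewrite adjointP rep_adjK. Qed.

Lemma nrm_adj_rep g x : nrm (adjoint (U g) x) = nrm x.
Proof. by rewrite adj_rep /nrm; congr complex.Re; apply/eqP;
  rewrite -(@eqrXn2 _ 2)// -!dot_norm dot_rep. Qed.

Lemma vcontinuous_adj_rep x : vcontinuous (fun g => adjoint (U g) x).
Proof.
move=> g e e0.
have : (fun h : G => U h^-1%g x) @ g --> U g^-1%g x.
  apply: (@continuous_comp _ _ _ (fun h : G => h^-1%g) (fun h => U h x) g).
    exact: invg_continuous.
  exact: rep_continuous.
move=> /cvgrPdist_lt /(_ e%:C); rewrite ltcR => /(_ e0).
by apply: filterS => h; rewrite nrmE ltcR nrmBC !adj_rep.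
Qed.

(** The matrix coefficient of U_g T U_g^*, with U_g moved to the left so that the
    integrand only involves orbit maps g |-> U_g^* x. *)
Definition coef (T : 'B(H)) x y g := dot (adjoint (U g) x) (T (adjoint (U g) y)).

Lemma coefE T x y g : dot x (comp_op (U g) (comp_op T (adjoint (U g))) y) = coef T x y g.
Proof. by rewrite /coef adjointP. Qed.

Lemma bounded_borel_rep (S T : 'B(H)) x y :
  bounded_borel (fun g => dot (S (adjoint (U g) x)) (T (adjoint (U g) y))).
Proof.
have [M M0 SM] := op_bound S; have [N N0 TN] := op_bound T.
apply: (@bounded_borel_dot _ _ _ _ _ (M * nrm x) (N * nrm y)).
- by apply: vcontinuous_op; exact: vcontinuous_adj_rep.
- by apply: vcontinuous_op; exact: vcontinuous_adj_rep.
- by move=> g; rewrite (le_trans (SM _))// nrm_adj_rep.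
- by move=> g; rewrite (le_trans (TN _))// nrm_adj_rep.
Qed.

Lemma bounded_borel_coef T x y : bounded_borel (coef T x y).
Proof. exact: (bounded_borel_rep (id_op H) T x y). Qed.

Lemma coef_translate T x y g h :
  coef T x y (h * g)%g = coef T (adjoint (U h) x) (adjoint (U h) y) g.
Proof. by rewrite /coef !adj_repM. Qed.

End representations.

Section covariance.
Context {R : realType} {G : topologicalGroupType} (C : covariant_system R G).

Lemma translation_measurable (h : G) :
  measurable_fun [set: Bor G] (fun g : Bor G => (h * g)%g : Bor G).
Proof.
apply: (@measurability _ _ (Bor G) (Bor G) setT _ (@open G)) => // _ [A oA <-].
rewrite setTI; apply: open_borel.
have : continuous (fun g : G => (h * g)%g).
  move=> g; apply: (@continuous_comp _ _ _ (fun g : G => (h, g)) (fun x : G * G => (x.1 * x.2)%g)).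
    by apply: cvg_pair => /=; [exact: cvg_cst|exact: cvg_id].
  exact: mulg_continuous.
by move=> /continuousP; exact.
Qed.

(** Covariance as a change of variables: translating the pieces and the sample
    points by h^-1 turns a Riemann sum of one side into one of the other, and
    <W_h^* x, E(h^-1 A) W_h^* y> = <x, E(A) y>. *)
Lemma povm_integral_translate (h : G) (x y : cs_space C) (f : G -> R[i]) :
  bounded_borel f ->
  povm_integral (cs_povm C) (adjoint (cs_rep C h) x) (adjoint (cs_rep C h) y)
    (fun g => f (h * g)%g) = povm_integral (cs_povm C) x y f.
Proof.
move=> bf; set E := cs_povm C; set x' := adjoint _ x; set y' := adjoint _ y.
have bf' : bounded_borel (fun g => f (h * g)%g).
  have [fr fi [M fM]] := bf; split; last by exists M.
  - exact: (measurableT_comp fr (translation_measurable h)).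
  - exact: (measurableT_comp fi (translation_measurable h)).
apply: eq_approx => e e0.
have [K [K0 KP]] := povm_integral_approx E x y.
have [K' [K'0 K'P]] := povm_integral_approx E x' y'.
have k0 : 0 < K + K' + 1 by rewrite ltr_wpDl// addr_ge0.
have d0 : 0 < e / (K + K' + 1) by rewrite divr_gt0.
have [L [q [p [mq fq]]]] := @fine_partition _ _ _ (1%g : Bor G) unit (fun=> f)
  _ d0 (fun=> bf).
have h1 := KP _ _ _ _ _ mq bf (fq tt).
pose q' g := q (h * g)%g; pose p' l := (h^-1 * p l)%g.
have mq' : measurable_fibers (q' : Bor G -> L).
  move=> l; rewrite -[X in measurable X]setTI.
  by apply: (translation_measurable h measurableT (mq l)).
have h2 : normc (povm_integral E x' y' (fun g => f (h * g)%g) -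
    \sum_l f (p l) * dot x (E (q @^-1` [set l]) y)) <= K' * (e / (K + K' + 1)).
  have := K'P _ q' p' _ (e / (K + K' + 1)) mq' bf'.
  have -> : \sum_l f (h * p' l)%g * dot x' (E (q' @^-1` [set l]) y') =
      \sum_l f (p l) * dot x (E (q @^-1` [set l]) y).
    apply: eq_bigr => l _; rewrite /p' mulVKg; congr (_ * _).
    have := @cs_covariant _ _ C h _ (mq' l); rewrite -/E => /(congr1 (fun T : 'B(_) => dot x (T y))).
    rewrite /x' adjointP => ->; congr (dot _ (E _ _)).
    apply/seteqP; split=> [_ [g /= <- <-]//|g /= <-].
    by exists (h^-1 * g)%g; rewrite ?mulVKg// /q' /= mulVKg.
  by apply=> g; rewrite /p' /q' mulVKg; exact: (fq tt).
move: h1 h2; set S := \sum_l _ => h1 h2.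
have -> : povm_integral E x' y' (fun g => f (h * g)%g) - povm_integral E x y f =
  (povm_integral E x' y' (fun g => f (h * g)%g) - S) - (povm_integral E x y f - S).
  by ring.
rewrite (le_trans (le_normcD _ _))// normcN (le_trans (lerD h2 h1))//.
have : e / (K + K' + 1) * (K + K' + 1) = e by rewrite divfK// gt_eqF.
by move: d0; move: (e / _) => d d0; lra.
Qed.

End covariance.

Section relativization.
Context {R : realType} {G : topologicalGroupType} {HS HT : hilbertType R}.
Variables (US : unitary_rep G HS) (C : covariant_system R G).
Variable t : hilbert_tensor HS (cs_space C) HT.
Local Notation E := (cs_povm C).
Local Notation HR := (cs_space C).
Local Notation tp := (tens_pair t).
Local Notation adj g := (adjoint (US g)).
Implicit Types (S T : 'B(HS)) (a b : HS * HR) (r s : seq (R[i] * (HS * HR))).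

Definition yform T a b := povm_integral E a.2 b.2 (coef US T a.1 b.1).

(** The form of the relativization of T^* T. *)
Definition ysquare T a b := povm_integral E a.2 b.2
  (fun g => dot (T (adj g a.1)) (T (adj g b.1))).

Lemma yform_id a b : yform (id_op HS) a b = dot (tp a) (tp b).
Proof.
rewrite dot_tens /yform -(povm_integral_cst E); congr povm_integral.
by apply/funext => g; rewrite /coef /= dot_adj_rep.
Qed.

Lemma yform_conj T a b : (povm_integral E b.2 a.2
  (fun g => dot (T (adj g b.1)) (adj g a.1))) = (yform T a b)^*%C.
Proof.
rewrite /yform -povm_integral_conj; last exact: bounded_borel_coef.
by congr povm_integral; apply/funext => g; rewrite /coef dotC.
Qed.

(** The Cauchy-Schwarz inequality for the form of [T], from the positivity of
    the Gram matrix of the vectors U_g^* xi and T U_g^* xi'. *)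
Lemma yform_schwarz T r s :
  normc (\sum_(p <- r) \sum_(q <- s) p.1^*%C * q.1 * yform T p.2 q.2) ^+ 2 <=
  nrm (comb tp r) ^+ 2 * complex.Re
    (\sum_(p <- s) \sum_(q <- s) p.1^*%C * q.1 * ysquare T p.2 q.2).
Proof.
set z := \sum_(p <- r) _; set Q := \sum_(p <- s) _.
apply: psd2_bound; first exact: sqr_ge0.
move=> l; pose w (c : bool * (HS * HR)) g := if c.1 then T (adj g c.2.1) else adj g c.2.1.
have bw c d : bounded_borel (fun g => dot (w c g) (w d g)).
  case: c d => [[] c] [[] d]; rewrite /w/=.
  - exact: bounded_borel_rep.
  - exact: (bounded_borel_rep US T (id_op HS)).
  - exact: (bounded_borel_rep US (id_op HS) T).
  - exact: (bounded_borel_rep US (id_op HS) (id_op HS)).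
have := @povm_integral_psd_kernel _ _ _ E _ (fun c => c.2.2) _ bw.
move=> /(_ (fun g => gram_psd_kernel _)).
move=> /(_ ([seq (l^*%C * p.1, (false, p.2)) | p <- r] ++
           [seq (p.1, (true, p.2)) | p <- s])).
rewrite big_cat !big_map/=.
under eq_bigr do rewrite big_cat !big_map/=.
under [X in _ + X]eq_bigr do rewrite big_cat !big_map/=.
rewrite !big_split/=.
have -> : \sum_(p <- r) \sum_(q <- r) (l^*%C * p.1)^*%C * (l^*%C * q.1) *
    povm_integral E p.2.2 q.2.2 (fun g => dot (adj g p.2.1) (adj g q.2.1)) =
    (normc l ^+ 2 * nrm (comb tp r) ^+ 2)%:C.
  rewrite rmorphM/= -mulJc -dotxx dot_comb mulr_sumr; apply: eq_bigr => p _.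
  rewrite mulr_sumr; apply: eq_bigr => q _; rewrite -yform_id rmorphM/= conjcK.
  by rewrite /yform /coef/=; ring.
have -> : \sum_(p <- r) \sum_(q <- s) (l^*%C * p.1)^*%C * q.1 *
    povm_integral E p.2.2 q.2.2 (fun g => dot (adj g p.2.1) (T (adj g q.2.1))) =
    l * z.
  rewrite mulr_sumr; apply: eq_bigr => p _; rewrite mulr_sumr.
  by apply: eq_bigr => q _; rewrite rmorphM/= conjcK !mulrA.
have -> : \sum_(p <- s) \sum_(q <- r) p.1^*%C * (l^*%C * q.1) *
    povm_integral E p.2.2 q.2.2 (fun g => dot (T (adj g p.2.1)) (adj g q.2.1)) =
    (l * z)^*%C.
  rewrite exchange_big rmorphM rmorph_sum/= mulr_sumr; apply: eq_bigr => p _.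
  rewrite rmorph_sum mulr_sumr; apply: eq_bigr => q _.
  by rewrite yform_conj !rmorphM/= conjcK; ring.
have -> : \sum_(p <- s) \sum_(q <- s) p.1^*%C * q.1 *
    povm_integral E p.2.2 q.2.2 (fun g => dot (T (adj g p.2.1)) (T (adj g q.2.1))) =
    Q by [].
rewrite ge0_complexE => /andP[_]; rewrite !ReD ReJ; congr (0 <= _).
by rewrite [complex.Re _%:C]/=; ring.
Qed.

(** The kernel M^2 <x, y> - <T x, T y> is positive semidefinite when [M] bounds
    [T], and the integral of its first term is the inner product of tensors. *)
Lemma ysquare_le T (M : R) s : 0 <= M -> (forall x, nrm (T x) <= M * nrm x) ->
  complex.Re (\sum_(p <- s) \sum_(q <- s) p.1^*%C * q.1 * ysquare T p.2 q.2) <=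
  M ^+ 2 * nrm (comb tp s) ^+ 2.
Proof.
move=> M0 TM.
pose f (a b : HS * HR) g := (- 1) * dot (T (adj g a.1)) (T (adj g b.1)) +
  (M ^+ 2)%:C * dot (adj g a.1) (adj g b.1).
have b1 a b : bounded_borel (fun g => dot (T (adj g a.1)) (T (adj g b.1))).
  exact: bounded_borel_rep.
have b2 a b : bounded_borel (fun g => (M ^+ 2)%:C * dot (adj g a.1) (adj g b.1)).
  apply: bounded_borelM; first exact: bounded_borel_cst.
  exact: (bounded_borel_rep US (id_op HS) (id_op HS)).
have bf a b : bounded_borel (f a b).
  apply: bounded_borelD => //; apply: bounded_borelM => //; exact: bounded_borel_cst.
have fpsd g : psd_kernel (fun a b => f a b g).
  move=> r; have -> : \sum_(p <- r) \sum_(q <- r) p.1^*%C * q.1 * f p.2 q.2 g =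
     (M ^+ 2)%:C * dot (\sum_(p <- r) p.1 *: adj g p.2.1) (\sum_(p <- r) p.1 *: adj g p.2.1) -
     dot (T (\sum_(p <- r) p.1 *: adj g p.2.1)) (T (\sum_(p <- r) p.1 *: adj g p.2.1)).
    rewrite op_sum !dot_suml mulr_sumr -sumrB; apply: eq_bigr => p _.
    rewrite !dot_sumr mulr_sumr -sumrB; apply: eq_bigr => q _.
    by rewrite !opZ !dotZl !dotZr /f; ring.
  rewrite !dotxx -rmorphM -rmorphB ler0c subr_ge0 -exprMn.
  by rewrite ler_pXn2r ?nnegrE ?mulr_ge0 ?nrm_ge0.
have := @povm_integral_psd_kernel _ _ _ E _ snd _ bf fpsd s.
have -> : \sum_(p <- s) \sum_(q <- s) p.1^*%C * q.1 *
    povm_integral E p.2.2 q.2.2 (f p.2 q.2) = (M ^+ 2 * nrm (comb tp s) ^+ 2)%:C -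
    \sum_(p <- s) \sum_(q <- s) p.1^*%C * q.1 * ysquare T p.2 q.2.
  rewrite rmorphM/= -dotxx dot_comb mulr_sumr -sumrB; apply: eq_bigr => p _.
  rewrite mulr_sumr -sumrB; apply: eq_bigr => q _.
  rewrite povm_integral_linear// -yform_id /yform.
  have -> : (fun g => (M ^+ 2)%:C * dot (adj g p.2.1) (adj g q.2.1)) =
    (fun g => (M ^+ 2)%:C * coef US (id_op HS) p.2.1 q.2.1 g + 0).
    by apply/funext => g; rewrite addr0.
  rewrite (povm_integral_linear _ _ _ _ (bounded_borel_coef _ _ _ _) (bounded_borel_cst _)).
  by rewrite povm_integral_cst mul0r addr0 /ysquare; ring.
by rewrite ge0_complexE => /andP[_]; rewrite ReB subr_ge0.
Qed.

Lemma yen_exists T (M : R) : 0 <= M -> (forall x, nrm (T x) <= M * nrm x) ->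
  exists V : 'B(HT), (forall a b, dot (tp a) (V (tp b)) = yform T a b) /\
    (forall x, nrm (V x) <= M * nrm x).
Proof.
move=> M0 TM; apply: (form_op (tens_total t)) => // r s.
rewrite -(ler_pXn2r (n := 2)) ?nnegrE ?normc_ge0 ?mulr_ge0 ?nrm_ge0//.
rewrite (le_trans (yform_schwarz _ _ _))// !exprMn.
rewrite -[leRHS]mulrA [leRHS]mulrCA ler_wpM2l ?sqr_ge0//.
exact: ysquare_le.
Qed.

Lemma yenP T a b : dot (tp a) (yen US t T (tp b)) = yform T a b.
Proof.
have [M M0 TM] := op_bound T; have [V [VE _]] := yen_exists M0 TM.
have VP : forall xi xi' eta eta', dot (t xi eta) (V (t xi' eta')) =
    povm_integral E eta eta' (fun g =>
      dot xi (comp_op (US g) (comp_op T (adjoint (US g))) xi')).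
  move=> x x' y y'; rewrite (VE (x, y) (x', y')) /yform; congr povm_integral.
  by apply/funext => g; rewrite coefE.
rewrite /yen; case: xgetP => [W _ WP|/(_ V)]; last by case/(_ VP).
rewrite WP /yform; congr povm_integral.
by apply/funext => g; rewrite coefE.
Qed.

Lemma yen_unique T (V : 'B(HT)) :
  (forall a b, dot (tp a) (V (tp b)) = yform T a b) -> yen US t T = V.
Proof.
move=> VE; apply: (op_eq_total (tens_total t)) => b.
by apply: (total_dot_inj (tens_total t)) => a; rewrite yenP VE.
Qed.

Lemma yen_bound T (M : R) : 0 <= M -> (forall x, nrm (T x) <= M * nrm x) ->
  forall x, nrm (yen US t T x) <= M * nrm x.
Proof.
by move=> M0 TM x; have [V [/yen_unique-> VM]] := yen_exists M0 TM.
Qed.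

Lemma yform_linear (c : R[i]) S T a b :
  yform (c *: S + T) a b = c * yform S a b + yform T a b.
Proof.
rewrite /yform -povm_integral_linear; try exact: bounded_borel_coef.
by congr povm_integral; apply/funext => g; rewrite /coef -dotZr -dotDr.
Qed.

Lemma yen_linear (c : R[i]) S T :
  yen US t (c *: S + T) = c *: yen US t S + yen US t T.
Proof.
apply: yen_unique => a b; rewrite yform_linear -!yenP.
by rewrite -dotZr -dotDr.
Qed.

Lemma yenB S T : yen US t (S - T) = yen US t S - yen US t T.
Proof.
have -> : S - T = (-1) *: T + S by rewrite scaleN1r addrC.
by rewrite yen_linear scaleN1r addrC.
Qed.

Lemma yen_adjoint T : adjoint (yen US t T) = yen US t (adjoint T).
Proof.
apply/esym/yen_unique => a b; rewrite adjointPr dotC yenP.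
rewrite -yform_conj /yform; congr povm_integral.
by apply/funext => g; rewrite /coef -adjointPr.
Qed.

(** The Kadison-Schwarz inequality on elementary tensors: the case of
    [yform_schwarz] in which the second combination is one tensor. *)
Lemma yen_schwarz T a :
  nrm (yen US t T (tp a)) ^+ 2 <= complex.Re (ysquare T a a).
Proof.
have h r : normc (dot (comb tp r) (yen US t T (tp a))) ^+ 2 <=
    nrm (comb tp r) ^+ 2 * complex.Re (ysquare T a a).
  have := yform_schwarz T r [:: (1, a)].
  rewrite [X in _ * complex.Re X](_ : _ = ysquare T a a); last first.
    by rewrite !big_seq1 conjc1 !mul1r.
  congr (normc _ ^+ 2 <= _); rewrite dot_suml; apply: eq_bigr => p _.
  by rewrite big_seq1 mulr1 dotZl yenP.
have Q0 : 0 <= complex.Re (ysquare T a a).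
  have := @povm_integral_ge0 _ _ _ E a.2 (fun g => dot (T (adj g a.1)) (T (adj g a.1)))
    (bounded_borel_rep _ _ _ _ _) (fun g => dotxx_ge0 _).
  by rewrite ge0_complexE => /andP[].
rewrite -(sqr_sqrtr Q0) ler_pXn2r ?nnegrE ?nrm_ge0 ?sqrtr_ge0//.
apply: (total_nrm_le (tens_total t)) => [|r]; first exact: sqrtr_ge0.
rewrite -(ler_pXn2r (n := 2)) ?nnegrE ?normc_ge0 ?mulr_ge0 ?nrm_ge0 ?sqrtr_ge0//.
by rewrite exprMn sqr_sqrtr// mulrC.
Qed.

(** Positivity of the matrix [T] at the vectors U_g^* xi, grouped by block, says
    that the integrand is a positive semidefinite kernel on pairs of a block
    index and a tensor. *)
Lemma yen_completely_positive : completely_positive (yen US t).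
Proof.
split; first exact: yen_linear.
move=> n T Tpos; apply: (positive_mx_total (tens_total t)) => s.
pose f (a b : 'I_n * (HS * HR)) g := coef US (T a.1 b.1) a.2.1 b.2.1 g.
have bf c d : bounded_borel (f c d) by exact: bounded_borel_coef.
have fpsd g : psd_kernel (fun c d => f c d g).
  move=> r; pose x k := \sum_(p <- r | p.2.1 == k) p.1 *: adj g p.2.2.1.
  have := Tpos x; congr (0 <= _).
  rewrite [RHS](partition_big (fun p => p.2.1) xpredT)//=; apply: eq_bigr => k _.
  under [RHS]eq_bigr do rewrite (partition_big (fun p => p.2.1) xpredT)//=.
  rewrite [RHS]exchange_big/=; apply: eq_bigr => l _.
  rewrite /x dot_suml; apply: eq_bigr => p /eqP pk.
  rewrite op_sum dot_sumr; apply: eq_bigr => q /eqP ql.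
  by rewrite opZ dotZl dotZr mulrA /f /coef pk ql.
pose r := [seq (p.1, (k, p.2)) | k <- enum 'I_n, p <- s k].
have := @povm_integral_psd_kernel _ _ _ E _ (fun c => c.2.2) _ bf fpsd r.
rewrite /r big_allpairs_dep big_enum/=; congr (0 <= _); apply: eq_bigr => k _.
under eq_bigr do rewrite big_allpairs_dep big_enum/=.
rewrite exchange_big/=; apply: eq_bigr => l _.
rewrite mxE /comb dot_suml; apply: eq_bigr => p _.
rewrite op_sum dot_sumr; apply: eq_bigr => q _.
by rewrite opZ dotZl dotZr mulrA yenP.
Qed.

(** Isometries preserve inner products of elementary tensors, so the map on
    tensors extends by [ext_op] with constant 1. *)
Lemma tensor_op_isometry (S : 'B(HS)) (W : 'B(HR)) :
  (forall x y, dot (S x) (S y) = dot x y) ->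
  (forall x y, dot (W x) (W y) = dot x y) ->
  forall x y, tensor_op t S W (t x y) = t (S x) (W y).
Proof.
move=> Siso Wiso x y.
have [s|V [VE _]] := @ext_op _ _ _ tp (tens_total t) _ (fun a => t (S a.1) (W a.2)) 1 ler01.
  rewrite mul1r; apply: nrm_le_sqr; first exact: nrm_ge0.
  rewrite !nrm_dot -[X in dot X X]/(comb (fun a => t (S a.1) (W a.2)) s) !dot_comb.
  rewrite le_eqVlt; apply/orP; left; apply/eqP; congr complex.Re.
  apply: eq_bigr => p _; apply: eq_bigr => q _.
  by rewrite dot_tens tens_dot Siso Wiso.
rewrite /tensor_op; case: xgetP => [V' _ ->//|/(_ V)]; case=> x' y'.
exact: (VE (x', y')).
Qed.

Lemma yen_fixed T : fixed_points (fun g => tensor_op t (US g) (cs_rep C g)) (yen US t T).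
Proof.
move=> g; set V := tensor_op t _ _.
have VE a : V (tp a) = tp (US g a.1, cs_rep C g a.2).
  by apply: tensor_op_isometry => x y; exact: dot_rep.
have VaE a : adjoint V (tp a) = tp (adj g a.1, adjoint (cs_rep C g) a.2).
  apply: (total_dot_inj (tens_total t)) => b.
  by rewrite adjointPr VE !dot_tens/= !adjointPr.
apply/esym/yen_unique => a b; rewrite /= -adjointP !VaE yenP /yform/=.
rewrite -[RHS](povm_integral_translate g); last exact: bounded_borel_coef.
by congr povm_integral; apply/funext => h; rewrite coef_translate.
Qed.

(** For invariant [T] the integrand is the constant <xi, T xi'>. *)
Lemma yen_of_fixed T : fixed_points US T -> yen US t T = tensor_op t T (id_op HR).
Proof.
move=> Tfix; have yT x y : yen US t T (t x y) = t (T x) y.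
  apply: (total_dot_inj (tens_total t)) => a; rewrite (yenP T a (x, y)).
  rewrite (dot_tens t a (T x, y)) /yform -(povm_integral_cst E); congr povm_integral.
  by apply/funext => g; rewrite /= -coefE Tfix.
rewrite /tensor_op; case: xgetP => [V _ VE|/(_ (yen US t T))]; last by case/(_ yT).
by apply: (op_eq_total (tens_total t)) => -[x y]; rewrite /tens_pair/= yT VE.
Qed.

End relativization.

(** * Strong convergence of relativized operators *)

Section countable_partitions.
Context {R : realType} {G : topologicalGroupType}.

(** The members of a countable base on which [u] oscillates by less than [e] still
    cover [G].  They are numbered by an injection [f] into the integers, and the
    union in the witness has at most one member. *)
Lemma small_oscillation_cover (H : hilbertType R) (u : G -> H) (e : R) :
  @second_countable G -> vcontinuous u -> 0 < e ->
  exists b : nat -> set G, [/\ forall n, open (b n),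
    forall g, exists n, b n g &
    forall n g h, b n g -> b n h -> nrm (u g - u h) < e].
Proof.
move=> [B /countable_injP[f finj] [Bo Bb]] cu e0.
pose B' := [set V | B V /\ forall g h, V g -> V h -> nrm (u g - u h) < e].
exists (fun n => \bigcup_(V in [set V | B' V /\ f V = n]) V); split.
- by move=> n; apply: bigcup_open => V [[BV _] _]; exact: Bo.
- move=> g; have e2 : 0 < e / 2 by rewrite divr_gt0.
  have [V [BV Vg] Vu] := Bb g _ (cu g _ e2).
  exists (f V), V => //; split=> //; split=> // h k Vh Vk.
  rewrite (le_lt_trans (nrm_triangle (u g) _ _))// (splitr e) ltrD//.
    exact: Vu.
  by rewrite nrmBC; exact: Vu.
- move=> n g h [V [[BV VP] fV] Vg] [W [[BW _] fW] Wh].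
  have VW : V = W by apply: finj; rewrite ?inE// fV fW.
  by apply: VP => //; rewrite VW.
Qed.

(** Continuity of the finite measure <x, E(.) x> along the exhaustion of [G] by
    the first pieces. *)
Lemma povm_tail (H : hilbertType R) (E : povm G H) (x : H)
    (A : nat -> set (Bor G)) (e : R) :
  (forall n, measurable (A n)) -> trivIset setT A -> \bigcup_n A n = setT ->
  0 < e -> exists N, nrm x ^+ 2 - \sum_(i < N) complex.Re (dot x (E (A i) x)) < e.
Proof.
move=> mA tA UA e0; have := @povm_sigma_additive _ _ _ E _ mA tA x x.
rewrite UA povmT => /cvgrPdist_lt /(_ e%:C); rewrite ltcR => /(_ e0) /filter_ex[N].
rewrite normr_normc ltcR => h; exists N; apply: le_lt_trans h.
apply: le_trans (le_trans (ler_norm _) (normc_le_Re _)).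
rewrite ReB big_mkord nrm_dot lerD2l lerN2 le_eqVlt; apply/orP; left; apply/eqP.
by apply: (big_morph _ ReD).
Qed.

End countable_partitions.

Section strong_continuity.
Context {R : realType} {G : topologicalGroupType} {HS HT : hilbertType R}.
Variables (US : unitary_rep G HS) (C : covariant_system R G).
Variable t : hilbert_tensor HS (cs_space C) HT.
Hypothesis G_sc : @second_countable G.
Local Notation E := (cs_povm C).
Local Notation tp := (tens_pair t).
Local Notation adj g := (adjoint (US g)).

(** Dominated convergence fails along filters; what replaces it is that the
    orbit g |-> U_g^* xi is, up to a set of small measure, within a small
    distance of finitely many of its values. *)
Lemma ysquare_small (a : HS * cs_space C) (M e : R) : 0 <= M -> 0 < e ->
  exists (N : nat) (x : 'I_N -> HS) (d : R), 0 < d /\ forall T : 'B(HS),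
    (forall y, nrm (T y) <= M * nrm y) -> (forall i, nrm (T (x i)) < d) ->
    complex.Re (ysquare US T a a) < e.
Proof.
move=> M0 e0; pose n := nrm a.2 ^+ 2; have n0 : 0 <= n by exact: sqr_ge0.
pose c := e / (2 * (n + 1)); have c0 : 0 < c by rewrite divr_gt0// mulr_gt0// ltr_wpDl.
pose K := M ^+ 2 * nrm a.1 ^+ 2; have K0 : 0 <= K by rewrite mulr_ge0 ?sqr_ge0.
pose d := Num.sqrt (c / (2 * (1 + M ^+ 2))).
have m0 : 0 < 1 + M ^+ 2 by rewrite ltr_pwDl// sqr_ge0.
have d0 : 0 < d by rewrite sqrtr_gt0 divr_gt0// mulr_gt0.
have d2 : d ^+ 2 * (2 * (1 + M ^+ 2)) = c.
  by rewrite sqr_sqrtr ?divfK ?gt_eqF ?mulr_gt0// ltW// divr_gt0// mulr_gt0.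
have [b [bo bc bd]] := small_oscillation_cover G_sc (vcontinuous_adj_rep US a.1) d0.
have /choice[g gb] : forall k, exists g, b k !=set0 -> b k g.
  by move=> k; have [[g bg]|nb] := pselect (b k !=set0); [exists g|exists 1%g].
pose A k : set (Bor G) := seqDU b k.
have mA k : measurable (A k).
  apply: measurableD; first exact: open_borel.
  by apply: bigsetU_measurable => j _; exact: open_borel.
have UA : \bigcup_k A k = setT.
  rewrite -seqDU_bigcup_eq; apply/seteqP; split=> // h _.
  by have [k bk] := bc h; exists k.
have eK : 0 < e / (2 * (K + 1)) by rewrite divr_gt0// mulr_gt0// ltr_wpDl.
have [N tail] := povm_tail E a.2 mA (trivIset_seqDU b) UA eK.
exists N, (fun i => adj (g i) a.1), d; split=> // T TM Td.
pose f h := dot (T (adj h a.1)) (T (adj h a.1)).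
pose s h := \sum_(i < N) (\1_(A i) h : R)%:C.
have bs : bounded_borel s.
  by apply: bounded_borel_sum => i; exact: bounded_borel_indic.
have bf : bounded_borel f by exact: bounded_borel_rep.
pose r h := (- K)%:C * s h + (c + K)%:C.
have br : bounded_borel r.
  apply: bounded_borelD; last exact: bounded_borel_cst.
  by apply: bounded_borelM => //; exact: bounded_borel_cst.
(* The majorant r is c on the first N pieces, where |T u_h| <= d (M + 1), and
   c + K on the rest, where only |T u_h| <= M |xi| is known. *)
have fr h : 0 <= (- 1) * f h + r h.
  rewrite /f /r dotxx.
  have -> : s h = (\sum_(i < N) (\1_(A i) h : R))%:C by rewrite rmorph_sum.
  rewrite mulN1r -rmorphN -!rmorphM -!rmorphD/= ler0c.
  have [[i Ai]|nA] := pselect (exists i : 'I_N, A i h).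
    rewrite (bigD1 i)//= indicE mem_set// big1 ?addr0; last first.
      move=> j ji; rewrite indicE memNset// => Aj.
      have /eqP := @trivIset_seqDU _ b i j I I (ex_intro _ h (conj Ai Aj)).
      by rewrite eq_sym; move: ji; rewrite -val_eqE => /negbTE ->.
    have bih : b i h by exact: subset_seqDU Ai.
    have gih := bd i h (g i) bih (gb i (ex_intro _ h bih)).
    have : nrm (T (adj h a.1)) <= d * (M + 1).
      rewrite -[adj h a.1](subrK (adj (g i) a.1)) opD (le_trans (nrmD _ _))//.
      rewrite mulrDr mulr1 lerD ?(ltW (Td i))// (le_trans (TM _))// mulrC.
      by rewrite ler_wpM2r// ltW.
    have := nrm_ge0 (T (adj h a.1)); move: (nrm _) d0 d2 M0 => w d0 <- M0 w0 wd.
    have := ler_pM w0 w0 wd wd.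
    have : 0 <= d ^+ 2 * (M - 1) ^+ 2 by rewrite mulr_ge0 ?sqr_ge0.
    by rewrite mulr1 !expr2; lra.
  rewrite big1 => [|i _]; last by rewrite indicE memNset// => Ai; apply: nA; exists i.
  rewrite mulr0 add0r addrC subr_ge0 (@le_trans _ _ K)//; last by rewrite lerDr ltW.
  rewrite /K -exprMn ler_pXn2r ?nnegrE ?mulr_ge0 ?nrm_ge0//.
  by rewrite (le_trans (TM _))// nrm_adj_rep.
have := povm_integral_ge0 E a.2 (bounded_borelD
  (bounded_borelM (bounded_borel_cst (- 1)) bf) br) fr.
rewrite povm_integral_linear// /r povm_integral_linear//; last exact: bounded_borel_cst.
rewrite povm_integral_cst dotxx -/n -[povm_integral _ _ _ f]/(ysquare US T a a).
have -> : povm_integral E a.2 a.2 s = \sum_(i < N) dot a.2 (E (A i) a.2).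
  have -> : s = fun h => \sum_(i < N) 1 * (\1_(A i) h : R)%:C.
    by apply/funext => h; apply: eq_bigr => i _; rewrite mul1r.
  rewrite povm_integral_sum => [|i]; last exact: bounded_borel_indic.
  by apply: eq_bigr => i _; rewrite mul1r povm_integral_indic.
rewrite ge0_complexE => /andP[_].
rewrite mulN1r !ReD ReN !ReZ (big_morph _ ReD (erefl : complex.Re 0 = 0)).
have -> : complex.Re n%:C = n by [].
move: tail; rewrite -/n; move: (\sum_i _) (complex.Re (ysquare _ _ _ _)) => S Y.
rewrite ltr_pdivlMr ?mulr_gt0 ?ltr_wpDl// => tail.
have cn : c * (2 * (n + 1)) = e by rewrite divfK// gt_eqF// mulr_gt0// ltr_wpDl.
by nra.
Qed.

Variables (X : Type) (F : set_system X) (FF : Filter F) (D : X -> 'B(HS)).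
Variables (M : R) (M0 : 0 <= M).
Hypothesis D_bounded : \forall i \near F, forall y, nrm (D i y) <= M * nrm y.
Hypothesis D_null : forall y (e : R), 0 < e -> \forall i \near F, nrm (D i y) < e.

Lemma yen_null_tensor a (e : R) : 0 < e ->
  \forall i \near F, nrm (yen US t (D i) (tp a)) < e.
Proof.
move=> e0; have [N [x [d [d0 small]]]] := ysquare_small a M0 (exprn_gt0 2 e0).
have xd : \forall i \near F, forall k, nrm (D i (x k)) < d.
  by apply: filter_forall => k; exact: D_null.
apply: filterS (filterI D_bounded xd) => i [DM Dd].
rewrite -(ltr_pXn2r (n := 2)) ?nnegrE ?nrm_ge0 ?(ltW e0)//.
exact: le_lt_trans (yen_schwarz _ _ _ _) (small _ DM Dd).
Qed.

(** Uniform boundedness extends convergence from tensors to all vectors. *)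
Lemma yen_null v (e : R) : 0 < e -> \forall i \near F, nrm (yen US t (D i) v) < e.
Proof.
move=> e0; have M1 : 0 < 2 * (M + 1) by rewrite mulr_gt0// ltr_wpDl.
have [s vs] := tens_total t v (divr_gt0 e0 M1).
have comb_null (r : seq (R[i] * (HS * cs_space C))) (d : R) : 0 < d ->
    \forall i \near F, nrm (yen US t (D i) (comb tp r)) < d.
  elim: r d => [|p r IH] d d0.
    by apply: filterE => i; rewrite comb_nil op0 nrm0.
  have d2 : 0 < d / 2 by rewrite divr_gt0.
  have k0 : 0 < normc p.1 + 1 by rewrite ltr_wpDl// normc_ge0.
  apply: filterS (filterI (yen_null_tensor p.2 (divr_gt0 d2 k0)) (IH _ d2)) => i [h1 h2].
  rewrite /comb big_cons opD opZ (le_lt_trans (nrmD _ _))// (splitr d) ltrD//.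
  rewrite nrmZ; move: h1; rewrite ltr_pdivlMr//.
  by have := nrm_ge0 (yen US t (D i) (tp p.2)); move: (nrm _) => w; lra.
have e2 : 0 < e / 2 by rewrite divr_gt0.
apply: filterS (filterI D_bounded (comb_null s _ e2)) => i [DM Ds].
rewrite -[v](subrK (comb tp s)) opD (le_lt_trans (nrmD _ _))// (splitr e).
rewrite ler_ltD// (le_trans (yen_bound US t M0 DM _))//.
move: vs; rewrite ltr_pdivlMr// ler_pdivlMr//.
by have := nrm_ge0 (v - comb tp s); move: (nrm _) => w; lra.
Qed.

End strong_continuity.

(** * Strict continuity *)

Section strict_topology.
Context {R : realType}.
Implicit Types H K : hilbertType R.

Lemma strict_near H (T0 : 'B(H)) x (e : R) : 0 < e ->
  \forall T \near (T0 : strict H),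
    nrm ((T : 'B(H)) x - T0 x) < e /\ nrm (adjoint T x - adjoint T0 x) < e.
Proof.
move=> e0; have : (@strict_eval R H : strict H -> _) @ (T0 : strict H) --> strict_eval T0.
  exact: (@initial_continuous _ _ (@strict_eval R H)).
have Fn : Filter (nbhs (T0 : strict H)) := nbhs_filter (T0 : strict H).
move=> /(@pointwise_cvgP _ _ _ _ (fmap_filter _ Fn))/(_ x) c.
have eC : 0 < e%:C by rewrite ltcR.
have b1 : nbhs (strict_eval T0 x) (ball (T0 x) e%:C `*` ball (adjoint T0 x) e%:C).
  by exists (ball (T0 x) e%:C, ball (adjoint T0 x) e%:C) => //; split => /=;
    exact: nbhsx_ballx.
have cb : \forall T \near (T0 : strict H),
    (ball (T0 x) e%:C `*` ball (adjoint T0 x) e%:C) (strict_eval T x) :=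
    c _ b1.
apply: filterS cb => T [] /=.
by rewrite -!ball_normE/= !nrmE !ltcR (nrmBC (T x)) (nrmBC (adjoint T x)).
Qed.

(** Strict continuity unfolded into convergence at each vector. *)
Lemma strictly_continuousP H K (f : 'B(H) -> 'B(K)) :
  (forall T0, unit_ball T0 -> forall v (e : R), 0 < e ->
    \forall T \near within (@unit_ball R H : set (strict H)) (nbhs (T0 : strict H)),
      nrm (f T v - f T0 v) < e /\ nrm (adjoint (f T) v - adjoint (f T0) v) < e) ->
  strictly_continuous_on_ball f.
Proof.
move=> h; apply: (@continuous_comp_initial _ _ _ (@strict_eval R K)).
apply/subspace_continuousP => T0 T0b; apply/pointwise_cvgP => v.
have c1 : (fun T => f T v) @ within (@unit_ball R H : set (strict H)) (nbhs (T0 : strict H))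
    --> f T0 v.
  apply/cvgrPdist_lt => e; rewrite ltcE => /andP[/eqP/= e_im e0].
  apply: filterS (h T0 T0b v _ e0) => T [h1 _].
  by rewrite nrmE ltcE/= e_im eqxx nrmBC.
have c2 : (fun T => adjoint (f T) v) @ within (@unit_ball R H : set (strict H)) (nbhs (T0 : strict H))
    --> adjoint (f T0) v.
  apply/cvgrPdist_lt => e; rewrite ltcE => /andP[/eqP/= e_im e0].
  apply: filterS (h T0 T0b v _ e0) => T [_ h1].
  by rewrite nrmE ltcE/= e_im eqxx nrmBC.
exact: (cvg_pair c1 c2).
Qed.

End strict_topology.

(** [yen_null] for T - T0 and for its adjoint, both bounded by 2 on the unit
    ball. *)
Lemma yen_strictly_continuous (R : realType) (G : topologicalGroupType)
    (HS HT : hilbertType R) (US : unitary_rep G HS) (C : covariant_system R G)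
    (t : hilbert_tensor HS (cs_space C) HT) :
  @second_countable G -> strictly_continuous_on_ball (yen US t).
Proof.
move=> G_sc; apply: strictly_continuousP => T0 T0b v e e0.
set F := within _ _.
have FF : Filter F := within_filter _ (nbhs_filter (T0 : strict HS)).
have ball_near : \forall T \near F, unit_ball (T : 'B(HS)) by apply: withinT.
have sub_ball (T : 'B(HS)) y : unit_ball T -> nrm ((T - T0) y) <= 2 * nrm y.
  move=> Tb; rewrite (le_trans (nrmB _ _))// mulr2n mulrDl mul1r lerD// -lecR -!nrmE.
    exact: Tb.
  exact: T0b.
have bd : \forall T \near F, forall y, nrm (((T : 'B(HS)) - T0) y) <= 2 * nrm y.
  by apply: filterS ball_near => T Tb y; exact: sub_ball.
have bda : \forall T \near F, forall y, nrm (adjoint ((T : 'B(HS)) - T0) y) <= 2 * nrm y.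
  by apply: filterS bd => T Tb; exact: adjoint_bound.
have null y (d : R) : 0 < d -> \forall T \near F, nrm (((T : 'B(HS)) - T0) y) < d.
  by move=> d0; apply: cvg_within; apply: filterS (strict_near T0 y d0) => T [].
have nulla y (d : R) : 0 < d -> \forall T \near F, nrm (adjoint ((T : 'B(HS)) - T0) y) < d.
  move=> d0; apply: cvg_within; apply: filterS (strict_near T0 y d0) => T [_].
  by rewrite adjointB.
have h1 := @yen_null _ _ _ _ US C t G_sc _ F FF _ 2 (ler0n _ 2) bd null v e e0.
have h2 := @yen_null _ _ _ _ US C t G_sc _ F FF _ 2 (ler0n _ 2) bda nulla v e e0.
apply: filterS (filterI h1 h2) => T [].
by rewrite -yen_adjoint !yenB adjointB.
Qed.

Theorem theorem4p9 (R : realType) (G : topologicalGroupType)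
    (G_lc : locally_compact [set: G]) (G_hausdorff : hausdorff_space G)
    (G_sc : @second_countable G)
    (HS : hilbertType R) (US : unitary_rep G HS)
    (C : covariant_system R G)
    (HT : hilbertType R) (t : hilbert_tensor HS (cs_space C) HT) :
  @hilbert_module_qrf R G (associated_coupling US (cs_rep C)) HT t (yen US t).
Proof.
split.
- exact: yen_fixed.
- exact: yen_completely_positive.
- exact: yen_strictly_continuous.
- exact: yen_of_fixed.
Qed.
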